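(* Let $\Omega\subset\mathbb{R}^n$, $n\in\{2,3\}$, be a bounded, connected Lipschitz domain with a shape regular simplicial mesh $\mathcal{T}_h$, and let $r\ge0$. Let $\mathbf{V}_h\subset\mathbf{H}_0(\operatorname{div})$ be the space of Raviart–Thomas elements of order $r$ or of Brezzi–Douglas–Marini elements of order $r+1$ on $\mathcal{T}_h$, and let $Q_h$ be the corresponding space of discontinuous piecewise polynomials of degree at most $r$ on $\mathcal{T}_h$ with zero mean. For a constant $K\in(0,1)$ consider the discrete mixed Darcy problem: find $\mathbf{u}_h\in\mathbf{V}_h$, $p_h\in Q_h$ such that $$a(\mathbf{u}_h,\mathbf{v})+b(\mathbf{v},p_h)=(\mathbf{f},\mathbf{v})\quad\forall\,\mathbf{v}\in\mathbf{V}_h,\qquad b(\mathbf{u}_h,q)=(g,q)\quad\forall\, q\in Q_h,$$ with $a(\mathbf{u},\mathbf{v})=(K^{-1}\mathbf{u},\mathbf{v})$ and $b(\mathbf{u},q)=(\nabla\cdot\mathbf{u},q)$, where the spaces are normed as $$\mathbf{V}_h=K^{-1/2}\mathbf{L}^2_h\cap\mathbf{H}_{0,h}(\operatorname{div}),\qquad Q_h=L^2_h+K^{1/2}H^1_h.$$ Then, under the corresponding norms, the Brezzi conditions are satisfied uniformly in $K$. That is, there exist constants $C_a,C_b,\alpha,\beta>0$ independent of $K\in(0,1)$ such that, for every $K\in(0,1)$: (i) $|a(\mathbf{u},\mathbf{v})|\le C_a\|\mathbf{u}\|_{\mathbf{V}_h}\|\mathbf{v}\|_{\mathbf{V}_h}$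 for all $\mathbf{u},\mathbf{v}\in\mathbf{V}_h$; (ii) $|b(\mathbf{v},q)|\le C_b\|\mathbf{v}\|_{\mathbf{V}_h}\|q\|_{Q_h}$ for all $\mathbf{v}\in\mathbf{V}_h$, $q\in Q_h$; (iii) $a(\mathbf{z},\mathbf{z})\ge\alpha\|\mathbf{z}\|_{\mathbf{V}_h}^2$ for all $\mathbf{z}\in\mathbf{Z}_h=\{\mathbf{z}\in\mathbf{V}_h: b(\mathbf{z},q)=0\ \forall q\in Q_h\}$; (iv) $\displaystyle\sup_{0\ne\mathbf{v}\in\mathbf{V}_h}\frac{b(\mathbf{v},q)}{\|\mathbf{v}\|_{\mathbf{V}_h}}\ge\beta\|q\|_{Q_h}$ for all $q\in Q_h$.
   Context: $(\cdot,\cdot)$ is the $L^2(\Omega)$ inner product (scalar or vector fields). $\mathbf{H}_0(\operatorname{div})$ is the space of $\mathbf{v}\in L^2(\Omega)^n$ with $\nabla\cdot\mathbf{v}\in L^2(\Omega)$ and zero normal trace on $\partial\Omega$, with $\|\mathbf{v}\|_{\mathbf{H}(\operatorname{div})}^2=\|\mathbf{v}\|_{L^2}^2+\|\nabla\cdot\mathbf{v}\|_{L^2}^2$. With $P_r$ the polynomials of degree at most $r$ (and $\tilde P_r$ the homogeneous ones of degree $r$), the Raviart–Thomas space of order $r$ consists of $\mathbf{v}\in\mathbf{H}_0(\operatorname{div})$ with $\mathbf{v}|_T\in P_r(T)^n+\mathbf{x}\tilde P_r(T)$ for every $T\in\mathcal{T}_h$, and the Brezzi–Douglas–Marini space of order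 $r+1$ of $\mathbf{v}\in\mathbf{H}_0(\operatorname{div})$ with $\mathbf{v}|_T\in P_{r+1}(T)^n$ for every $T\in\mathcal{T}_h$. The discrete gradient $\nabla_h:Q_h\to\mathbf{V}_h$ is defined by $(\nabla_h q,\mathbf{v})=-(q,\nabla\cdot\mathbf{v})$ for all $\mathbf{v}\in\mathbf{V}_h$; it is injective, and $\|q\|_{1,h}=\|\nabla_h q\|_{L^2}$ is a norm on $Q_h$. $H^1_h$ is the set $Q_h$ with norm $\|\cdot\|_{1,h}$ and $L^2_h$ is the set $Q_h$ with the $L^2$ norm. $\mathbf{L}^2_h$ and $\mathbf{H}_{0,h}(\operatorname{div})$ are the set $\mathbf{V}_h$ with the $L^2$ norm and the $\mathbf{H}(\operatorname{div})$ norm, respectively. For a Hilbert space $X$ and $\alpha>0$, $\alpha X$ is $X$ with norm $\|f\|_{\alpha X}^2=\alpha^2\|f\|_X^2$; $X\cap Y$ has norm $\|z\|_{X\cap Y}^2=\|z\|_X^2+\|z\|_Y^2$; $X+Y$ has norm $\|z\|_{X+Y}^2=\inf_{z=x+y,\,x\in X,\,y\in Y}\left(\|x\|_X^2+\|y\|_Y^2\right)$. In particular $\|q\|_{Q_h}^2=\inf_{\phi\in Q_h}\left(\|q-\phi\|_{L^2}^2+K\|\phi\|_{1,h}^2\right)$. *)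

(* Defs.v *)
(* Points and vectors of R^n are row vectors ['rV[R]_n] over a [realType].
   Elements of L^2 are represented by functions; representatives agree almost
   everywhere. *)
From HB Require Import structures.
From mathcomp Require Import all_boot all_order all_algebra.
From mathcomp Require Import -(notations) mpoly.
From mathcomp Require Import all_classical all_reals all_analysis.
Set Implicit Arguments.
Unset Strict Implicit.
Unset Printing Implicit Defensive.
Import Order.TTheory GRing.Theory Num.Theory.
Import numFieldNormedType.Exports.
Local Open Scope classical_set_scope.
Local Open Scope ring_scope.

Definition rV_display : measure_display -> measure_display.
Proof. exact. Qed.

(* The sigma-algebra generated by the coordinates, i.e. the Borel sets. *)
Section measurable_rV.
Context (R : realType) (n : nat).

Let coord : 'I_n -> 'rV[R]_n -> measurableTypeR R := fun i x => x ord0 i.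

Let rV_set0 : g_sigma_preimage coord set0.
Proof. exact: sigma_algebra0. Qed.

Let rV_setC A : g_sigma_preimage coord A -> g_sigma_preimage coord (~` A).
Proof. exact: sigma_algebraC. Qed.

Let rV_bigcup (F : _^nat) : (forall i, g_sigma_preimage coord (F i)) ->
  g_sigma_preimage coord (\bigcup_i (F i)).
Proof. exact: sigma_algebra_bigcup. Qed.

HB.instance Definition _ := @isMeasurable.Build
  (rV_display (R.-ocitv.-measurable).-sigma)
  'rV[R]_n (g_sigma_preimage coord) rV_set0 rV_setC rV_bigcup.

End measurable_rV.

Section cons_rV.
Context (R : realType).

Lemma measurable_coord n (i : 'I_n) :
  measurable_fun [set: 'rV[R]_n]
    (fun x : 'rV[R]_n => x ord0 i : measurableTypeR R).
Proof.
move=> _ Y mY; rewrite setTI; apply: sub_sigma_algebra => /=.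
rewrite -bigcup_seq/=; exists i => /=; first by rewrite mem_index_enum.
by exists Y => //; rewrite setTI.
Qed.

Lemma measurable_fun_rV d (T : measurableType d) n (f : T -> 'rV[R]_n) :
  (forall i, measurable_fun [set: T]
     (fun t => f t ord0 i : measurableTypeR R)) ->
  measurable_fun [set: T] f.
Proof.
move=> mf.
suff H : @measurable _ 'rV[R]_n `<=` [set A | measurable (f @^-1` A)].
  by move=> _ A mA; rewrite setTI; exact: H.
apply: smallest_sub.
  split.
  - by rewrite /= preimage_set0.
  - by move=> A mA; rewrite setTD /= -preimage_setC; exact: measurableC mA.
  - by move=> F mF; rewrite /= preimage_bigcup; apply: bigcup_measurable => k _; exact: mF.
rewrite -bigcup_seq; apply: bigcup_sub => i _ A [B mB <-].
by rewrite /= setTI -[X in measurable X]setTI; exact: mf.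
Qed.

Definition cons_rV n (p : measurableTypeR R * 'rV[R]_n) : 'rV[R]_n.+1 :=
  \row_i oapp (fun j => p.2 ord0 j) p.1 (unlift ord0 i).

Definition uncons_rV n (x : 'rV[R]_n.+1) : measurableTypeR R * 'rV[R]_n :=
  (x ord0 ord0, \row_j x ord0 (lift ord0 j)).

Lemma uncons_rVK n : cancel (@uncons_rV n) (@cons_rV n).
Proof.
move=> x; apply/rowP => i; rewrite mxE; case: unliftP => [j|] -> //=.
by rewrite mxE.
Qed.

Lemma cons_rVK n : cancel (@cons_rV n) (@uncons_rV n).
Proof.
move=> [t y]; rewrite /uncons_rV mxE unlift_none /=; congr pair.
by apply/rowP => j; rewrite !mxE liftK.
Qed.

Lemma measurable_cons_rV n : measurable_fun setT (@cons_rV n).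
Proof.
apply: measurable_fun_rV => i.
under eq_fun do rewrite mxE.
case: (unliftP ord0 i) => [j|] _ /=; last exact: measurable_fst.
exact: (measurableT_comp (measurable_coord j) measurable_snd).
Qed.

Lemma measurable_uncons_rV n : measurable_fun setT (@uncons_rV n).
Proof.
apply: measurable_fun_pair; first exact: measurable_coord.
apply: measurable_fun_rV => j /=.
under eq_fun do rewrite mxE.
exact: measurable_coord.
Qed.

End cons_rV.

Section lebesgue_rV_step.
Context (R : realType) (n : nat).
Local Open Scope ereal_scope.
Variable mu : {sigma_finite_measure set 'rV[R]_n -> \bar R}.

Definition lebesgue_rV_step : set 'rV[R]_n.+1 -> \bar R :=
  pushforward (@lebesgue_measure R \x mu) (@cons_rV R n).

Let step0 : lebesgue_rV_step set0 = 0.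
Proof. by rewrite /lebesgue_rV_step /pushforward preimage_set0 measure0. Qed.

Let step_ge0 A : 0 <= lebesgue_rV_step A.
Proof. by rewrite /lebesgue_rV_step /pushforward measure_ge0. Qed.

Let step_sigma_additive : semi_sigma_additive lebesgue_rV_step.
Proof.
move=> F mF tF mUF; rewrite /lebesgue_rV_step /pushforward preimage_bigcup.
have mpre A : measurable A -> measurable (@cons_rV R n @^-1` A).
  by move=> mA; rewrite -[X in measurable X]setTI; exact: measurable_cons_rV.
apply: measure_semi_sigma_additive => [k||].
- by apply: mpre; exact: mF.
- by apply/trivIsetP => /= i j _ _ ij; rewrite -preimage_setI;
     move/trivIsetP : tF => /(_ _ _ Logic.I Logic.I ij) ->; rewrite preimage_set0.
- by rewrite -preimage_bigcup; exact: mpre.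
Qed.

HB.instance Definition _ := isMeasure.Build _ _ _
  lebesgue_rV_step step0 step_ge0 step_sigma_additive.

Let step_sigma_finite : sigma_finite setT lebesgue_rV_step.
Proof.
have /sigma_finiteP[F [FT ndF Foo]] := sigma_finiteT (@lebesgue_measure R).
have /sigma_finiteP[G [GT ndG Goo]] := sigma_finiteT mu.
exists (fun k => @uncons_rV R n @^-1` (F k `*` G k)).
  rewrite -preimage_bigcup -(preimage_setT (@uncons_rV R n)); congr (_ @^-1` _).
  rewrite -setXTT FT GT predeqE => -[x y]; split.
    move=> [/= [k _ Fkx] [l _ Gly]]; exists (maxn k l) => //; split.
    - by move: x Fkx; exact/subsetPset/ndF/leq_maxl.
    - by move: y Gly; exact/subsetPset/ndG/leq_maxr.
  by move=> [k _ []/= ? ?]; split; exists k.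
move=> k; have [mF Fk] := Foo k; have [mG Gk] := Goo k; split.
  rewrite -[X in measurable X]setTI; apply: measurable_uncons_rV => //.
  exact: measurableX.
rewrite /lebesgue_rV_step /pushforward -comp_preimage.
rewrite (_ : _ \o _ = id); last by rewrite funeqE; exact: cons_rVK.
by rewrite preimage_id product_measure1E// lte_mul_pinfty// ge0_fin_numE.
Qed.

HB.instance Definition _ := Measure_isSigmaFinite.Build _ _ _
  lebesgue_rV_step step_sigma_finite.

End lebesgue_rV_step.

Fixpoint lebesgue_rV (R : realType) (n : nat) :
    {sigma_finite_measure set 'rV[R]_n -> \bar R} :=
  match n with
  | 0 => @dirac _ 'rV[R]_0 0 R
  | m.+1 => lebesgue_rV_step (lebesgue_rV R m)
  end.

Lemma lebesgue_rV_box (R : realType) (n : nat)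
    (A : 'I_n -> set (measurableTypeR R)) : (forall i, measurable (A i)) ->
  lebesgue_rV R n [set x | forall i, A i (x ord0 i)] =
    (\prod_(i < n) lebesgue_measure (A i))%E.
Proof.
elim: n A => [|n IH] A mA.
  by rewrite big_ord0 /= diracE mem_set// => -[].
have mB : measurable [set y : 'rV[R]_n | forall j, A (lift ord0 j) (y ord0 j)].
  rewrite (_ : mkset _ = \big[setI/setT]_(j < n)
      ((fun y : 'rV[R]_n => y ord0 j) @^-1` A (lift ord0 j))).
    apply: bigsetI_measurable => j _; rewrite -[X in measurable X]setTI.
    exact: measurable_coord.
  by rewrite -bigcap_seq; apply/seteqP; split=> y /= h j => [_|];
     [exact: h|apply: (h j); rewrite /= mem_index_enum].
rewrite big_ord_recl -(IH (fun j => A (lift ord0 j)))//=.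
rewrite -product_measure1E// /lebesgue_rV_step /pushforward; congr (_ _).
apply/seteqP; split=> [[t y] /= h|[t y] /= [h0 h] i].
  split; first by have := h ord0; rewrite mxE unlift_none.
  by move=> j; have := h (lift ord0 j); rewrite mxE liftK.
by rewrite mxE; case: unliftP => [j|] -> //=.
Qed.

Section function_spaces.
Context (R : realType) (n : nat).
Local Notation E := 'rV[R]_n.
Local Notation leb := (lebesgue_rV R n).
Implicit Types (D : set E) (f g : E -> R) (u v : E -> E).

Definition dot (x y : E) : R := \sum_i x ord0 i * y ord0 i.

(* ['rV[R]_n] carries the sup norm in the library. *)
Definition enorm (x : E) : R := Num.sqrt (dot x x).

Definition ip D f g : R := \int[leb]_(x in D) (f x * g x).
Definition ipv D u v : R := \int[leb]_(x in D) dot (u x) (v x).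

Definition normL2 D f : R := Num.sqrt (ip D f f).
Definition normL2v D v : R := Num.sqrt (ipv D v v).

Definition L2 D f : Prop :=
  measurable_fun D f /\ leb.-integrable D (fun x => (f x ^+ 2)%:E).
Definition L2v D v : Prop := forall i, L2 D (fun x => v x ord0 i).

Definition partial (i : 'I_n) f : E -> R :=
  fun x => 'D_(delta_mx ord0 i) (f : E -> R^o) x.

Definition grad f : E -> E := fun x => \row_i partial i f x.

Fixpoint Ck (k : nat) f : Prop :=
  match k with
  | 0 => continuous f
  | l.+1 => continuous f /\ forall i : 'I_n,
      (forall x, derivable (f : E -> R^o) x (delta_mx ord0 i)) /\
      Ck l (partial i f)
  end.

Definition smooth f : Prop := forall k, Ck k f.

Definition fun_support f : set E := closure [set x | f x != 0].

Definition test_function D f : Prop :=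
  [/\ smooth f, compact (fun_support f) & fun_support f `<=` D].

Definition weak_div D v g : Prop :=
  forall f, test_function D f -> ipv D v (grad f) = - ip D g f.

Definition Hdiv D v : Prop := L2v D v /\ exists g, L2 D g /\ weak_div D v g.

(* A representative of the weak divergence, unique almost everywhere. *)
Definition divergence D v : E -> R :=
  xget (cst 0) [set g | L2 D g /\ weak_div D v g].

(* The normal trace is the functional given by Green's formula,
   <v . nu, f> = (v, grad f) + (div v, f), on traces of functions f that are
   smooth up to the boundary; these are dense in H^1 of a bounded Lipschitz
   domain. *)
Definition normal_trace D v f : R := ipv D v (grad f) + ip D (divergence D v) f.

Definition H0div D v : Prop :=
  Hdiv D v /\ forall f, smooth f -> normal_trace D v f = 0.

Definition normHdiv D v : R :=
  Num.sqrt (normL2v D v ^+ 2 + normL2 D (divergence D v) ^+ 2).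

End function_spaces.

Section domains_and_meshes.
Context (R : realType) (n : nat).
Local Notation E := 'rV[R]_n.

(* Near each boundary point, [D] is the part above the graph of a Lipschitz
   function, the vertical direction being a unit vector [e] and the graph
   function being defined on the hyperplane orthogonal to [e]. *)
Definition lipschitz_boundary (D : set E) : Prop :=
  forall x0, (closure D `\` D) x0 ->
  exists (e : E) (gamma : E -> R) (L rho : R),
  [/\ enorm e = 1, 0 < rho,
      forall x y, dot x e = 0 -> dot y e = 0 ->
        `|gamma x - gamma y| <= L * enorm (x - y)
    & forall x, enorm (x - x0) < rho ->
        D x <-> gamma (x - dot x e *: e) < dot x e].

Definition bounded_lipschitz_domain (D : set E) : Prop :=
  [/\ D !=set0, open D, connected D, bounded_set D & lipschitz_boundary D].

Section simplices.
Context (I : finType) (p : I -> E).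
Implicit Types s : {set I}.

Definition affinely_independent s : Prop :=
  forall w : I -> R, \sum_(a in s) w a = 0 -> \sum_(a in s) w a *: p a = 0 ->
  forall a, a \in s -> w a = 0.

Definition hull s : set E :=
  [set x | exists w : I -> R, [/\ forall a, 0 <= w a,
     \sum_(a in s) w a = 1 & x = \sum_(a in s) w a *: p a]].

End simplices.

(* Cells are given by their sets of vertices; distinct cells meet in the
   (possibly empty) simplex spanned by their common vertices. *)
Record mesh (D : set E) := Mesh {
  vertex : finType;
  point : vertex -> E;
  cells : {set {set vertex}};
  _ : forall s, s \in cells -> #|s| = n.+1 /\ affinely_independent point s;
  _ : closure D = \bigcup_(s in [set` cells]) hull point s;
  _ : forall s t, s \in cells -> t \in cells ->
        hull point s `&` hull point t = hull point (s :&: t) }.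

Definition cell (D : set E) (Th : mesh D) (T : set E) : Prop :=
  exists2 s, s \in cells Th & T = hull (point (m:=Th)) s.

Definition diameter (T : set E) : R :=
  sup [set d | exists x y, [/\ T x, T y & d = enorm (x - y)]].

Definition inball_diameter (T : set E) : R :=
  sup [set d | exists c rho, [/\ 0 < rho, d = 2 * rho
                 & [set x | enorm (x - c) <= rho] `<=` T]].

(* [diameter] is h_T and [inball_diameter] is rho_T; [sigma] bounds h_T / rho_T. *)
Definition shape_regular (D : set E) (sigma : R) (Th : mesh D) : Prop :=
  forall T, cell Th T -> diameter T <= sigma * inball_diameter T.

End domains_and_meshes.

Inductive fe_family := RaviartThomas | BrezziDouglasMarini.

Section finite_elements.
Context (R : realType) (n : nat).
Local Notation E := 'rV[R]_n.
Local Notation leb := (lebesgue_rV R n).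

Definition peval (P : mpoly.mpoly n R) (x : E) : R :=
  mpoly.meval (fun i => x ord0 i) P.

(* [mpoly.msize P] is the degree plus one, and 0 for the zero polynomial. *)
Definition poly_le (r : nat) (f : E -> R) : Prop :=
  exists P : mpoly.mpoly n R, (mpoly.msize P <= r.+1)%N /\ f = peval P.

Definition poly_homog (r : nat) (f : E -> R) : Prop :=
  exists P : mpoly.mpoly n R, P \is mpoly.ishomog1 r mpoly.mdeg /\ f = peval P.

Definition poly_le_vec (r : nat) (v : E -> E) : Prop :=
  forall i, poly_le r (fun x => v x ord0 i).

Definition shape_functions (fam : fe_family) (r : nat) (v : E -> E) : Prop :=
  match fam with
  | RaviartThomas => exists v0 q, [/\ poly_le_vec r v0, poly_homog r q
                       & forall x, v x = v0 x + q x *: x]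
  | BrezziDouglasMarini => poly_le_vec r.+1 v
  end.

Context (D : set E) (Th : mesh D).

(* Almost everywhere on each closed cell, so that nothing is imposed on the
   common faces. *)
Definition piecewise (F : Type) (S : (E -> F) -> Prop) (f : E -> F) : Prop :=
  forall T, cell Th T ->
  exists2 g, S g & {ae leb, forall x, T x -> f x = g x}.

(* [Vh fam r] is the space of order [r] for Raviart-Thomas, and of order
   [r.+1] for Brezzi-Douglas-Marini. *)
Definition Vh (fam : fe_family) (r : nat) : set (E -> E) :=
  [set v | H0div D v /\ piecewise (shape_functions fam r) v].

Definition Qh (r : nat) : set (E -> R) :=
  [set q | [/\ L2 D q, piecewise (poly_le r) q & \int[leb]_(x in D) q x = 0]].

Context (fam : fe_family) (r : nat).

(* A representative of the discrete gradient, unique almost everywhere. *)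
Definition discrete_grad (q : E -> R) : E -> E :=
  xget (cst 0) [set s | Vh fam r s /\
    forall v, Vh fam r v -> ipv D s v = - ip D q (divergence D v)].

Definition norm1h (q : E -> R) : R := normL2v D (discrete_grad q).

End finite_elements.

Section norms.
Context (R : realType) (X : zmodType).

Definition norm_scale (alpha : R) (N : X -> R) : X -> R :=
  fun z => Num.sqrt (alpha ^+ 2 * N z ^+ 2).

Definition norm_cap (N1 N2 : X -> R) : X -> R :=
  fun z => Num.sqrt (N1 z ^+ 2 + N2 z ^+ 2).

Definition norm_sum (S1 : set X) (N1 : X -> R) (S2 : set X) (N2 : X -> R) :
    X -> R :=
  fun z => Num.sqrt (inf [set d | exists x y,
    [/\ S1 x, S2 y, z = x + y & d = N1 x ^+ 2 + N2 y ^+ 2]]).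

End norms.

Section darcy.
Context (R : realType) (n : nat).
Local Notation E := 'rV[R]_n.
Local Notation leb := (lebesgue_rV R n).
Context (D : set E) (Th : mesh D) (fam : fe_family) (r : nat) (K : R).

Definition a_form (u v : E -> E) : R := ipv D (fun x => K^-1 *: u x) v.
Definition b_form (v : E -> E) (q : E -> R) : R := ip D (divergence D v) q.

Definition norm_Vh : (E -> E) -> R :=
  norm_cap (norm_scale (Num.sqrt K)^-1 (normL2v D)) (normHdiv D).

Definition norm_Qh : (E -> R) -> R :=
  norm_sum (Qh Th r) (normL2 D)
    (Qh Th r) (norm_scale (Num.sqrt K) (norm1h Th fam r)).

Definition Zh : set (E -> E) :=
  [set z | Vh Th fam r z /\ forall q, Qh Th r q -> b_form z q = 0].

(* The supremum over nonzero (in L^2) elements of [Vh]; [sup] is real valued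
   and equals 0 on the empty set, which only occurs for [Vh = 0]. *)
Definition b_sup (q : E -> R) : R :=
  sup [set d | exists v, [/\ Vh Th fam r v,
    ~ {ae leb, forall x, D x -> v x = 0} & d = b_form v q / norm_Vh v]].

End darcy.

(* Main.v *)
(** The weak divergence of a field [v] of [Vh] is tested against products of
    one-dimensional bumps supported in small boxes: integrating by parts shows
    that it agrees almost everywhere in the interior of a cell with the
    divergence of the polynomial field that [v] equals there.  Cell boundaries
    are null, so the divergence maps [Vh] into [Qh], and [Zh] consists of the
    divergence-free fields; this gives (iii).

    For (iv), let [v] represent the functional [w |-> (q, div w)] with respect
    to the form [K^-1 (v, w) + (div v, div w)] on the finite-dimensional space
    [Vh].  Then [q = div v + y] with [grad_h y = - K^-1 v], and the cost of this
    decomposition is [K^-1 |v|^2 + |div v|^2 = b(v, q)], whereas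
    [|v|_V^2 <= 2 b(v, q)].  No inf-sup condition for the divergence enters, so
    the constants depend neither on [K] nor on the mesh. *)
Require Import Defs.
From HB Require Import structures.
From mathcomp Require Import all_boot all_order all_algebra.
From mathcomp Require Import -(notations) mpoly.
From mathcomp Require Import ring lra.
From mathcomp Require Import all_classical all_reals all_analysis measurable_realfun.
Set Implicit Arguments.
Unset Strict Implicit.
Unset Printing Implicit Defensive.
Import Order.TTheory GRing.Theory Num.Theory.
Import numFieldNormedType.Exports.
Local Open Scope classical_set_scope.
Local Open Scope ring_scope.

(** * Coordinate boxes and the Borel sets they generate *)

Section boxes.
Context (R : realType) (n : nat).
Local Notation E := 'rV[R]_n.+1.
Implicit Types (c d : 'I_n.+1 -> R) (U : set E).

(** Functions stand for their classes modulo null sets, and the divergence, the discrete gradient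
    and the polynomial pieces are picked by choice, so linearity can only be expected up to null
    sets. All bilinear forms are therefore treated as semi-inner products on subsets of a function
    space, and finite dimension enters only as a bound on the size of orthonormal families. The
    resulting Riesz theorem yields both the existence of the discrete gradient and the field used in
    (iv). Bumps are products over the coordinates because smoothness of every order and integration
    by parts then reduce to one variable, the rest being Fubini's theorem. A bump supported in a
    cell must also be supported in the domain, whereas the mesh covers the closure of the domain;
    this is where the Lipschitz boundary enters. The constants of (i) and (ii) are 1, by
    Cauchy-Schwarz; in (ii) the weights [K] and [K^-1] cancel. The constants 1/2 of (iii) and (iv)
    come from [K < 1]: the unweighted L^2 part of the norm of [Vh] is at most the part weighted by
    [K^-1]. *)

Definition obox c d : set E := [set x | forall i, c i < x ord0 i < d i].
Definition cbox c d : set E := [set x | forall i, c i <= x ord0 i <= d i].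

Lemma obox_cbox c d : obox c d `<=` cbox c d.
Proof. by move=> x xcd i; have /andP[/ltW -> /ltW ->] := xcd i. Qed.

Lemma measurable_coord_box (A : 'I_n.+1 -> set (measurableTypeR R)) :
  (forall i, measurable (A i)) ->
  measurable [set x : E | forall i, A i (x ord0 i)].
Proof.
move=> mA; rewrite (_ : mkset _ = \big[setI/setT]_(i < n.+1)
    ((fun x : E => x ord0 i) @^-1` A i)).
  apply: bigsetI_measurable => i _; rewrite -[X in measurable X]setTI.
  exact: measurable_coord.
by rewrite -bigcap_seq; apply/seteqP; split=> y /= h j => [_|];
  [exact: h|apply: (h j); rewrite /= mem_index_enum].
Qed.

Lemma measurable_obox c d : measurable (obox c d).
Proof.
rewrite (_ : obox c d =
    [set x | forall i, [set` `]c i, d i[] (x ord0 i)]); last first.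
  by apply/seteqP; split => x /= h i; have := h i; rewrite in_itv.
apply: (measurable_coord_box (A := fun i => [set` `]c i, d i[])) => i.
exact: measurable_itv.
Qed.

Lemma measurable_cbox c d : measurable (cbox c d).
Proof.
rewrite (_ : cbox c d =
    [set x | forall i, [set` `[c i, d i]] (x ord0 i)]); last first.
  by apply/seteqP; split => x /= h i; have := h i; rewrite in_itv.
apply: (measurable_coord_box (A := fun i => [set` `[c i, d i]])) => i.
exact: measurable_itv.
Qed.

Lemma compact_cbox c d : compact (cbox c d).
Proof.
rewrite (_ : cbox c d =
    [set x | forall i, [set` `[c i, d i]] (x ord0 i)]); last first.
  by apply/seteqP; split => x /= h i; have := h i; rewrite in_itv.
apply: (@rV_compact _ _ (fun i => [set` `[c i, d i]])) => i; exact: segment_compact.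
Qed.

(** Rational corners make the family of boxes countable, so that [pickle] can enumerate it. *)
Lemma open_rat_box U x : open U -> U x ->
  exists cd : 'rV[rat]_n.+1 * 'rV[rat]_n.+1,
    obox (fun i => ratr (cd.1 ord0 i)) (fun i => ratr (cd.2 ord0 i)) x /\
    cbox (fun i => ratr (cd.1 ord0 i)) (fun i => ratr (cd.2 ord0 i)) `<=` U.
Proof.
move=> oU Ux; have /nbhs_ballP[e /= e0 xeU] : nbhs x U by exact: open_nbhs_nbhs.
have /choice[c hc] i : exists q : rat, x ord0 i - e < ratr q < x ord0 i.
  have [q] := @rat_in_itvoo R (x ord0 i - e) (x ord0 i) ltac:(by rewrite ltrBlDr ltrDl).
  by rewrite in_itv; exists q.
have /choice[d hd] i : exists q : rat, x ord0 i < ratr q < x ord0 i + e.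
  have [q] := @rat_in_itvoo R (x ord0 i) (x ord0 i + e) ltac:(by rewrite ltrDl).
  by rewrite in_itv; exists q.
exists (\row_i c i, \row_i d i); split => [i|y xy].
  by rewrite !mxE; have /andP[_ ->] := hc i; have /andP[->] := hd i.
apply: xeU; split => // i j; rewrite (ord1 i) /ball /= ltr_distlC.
have := xy j; rewrite !mxE => /andP[cy yd].
have /andP[c1 _] := hc j; have /andP[_ d1] := hd j.
by rewrite (lt_le_trans c1 cy) (le_lt_trans yd d1).
Qed.

Lemma open_bigcup_obox U : open U -> exists c d : nat -> 'I_n.+1 -> R,
  (forall k, cbox (c k) (d k) `<=` U) /\ U = \bigcup_k obox (c k) (d k).
Proof.
move=> oU.
pose lo (cd : 'rV[rat]_n.+1 * 'rV[rat]_n.+1) i : R := ratr (cd.1 ord0 i).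
pose hi (cd : 'rV[rat]_n.+1 * 'rV[rat]_n.+1) i : R := ratr (cd.2 ord0 i).
(* Codes of no box, or of a box not inside [U], are sent to the corners 1 and 0, whose box is empty
   because the dimension is positive. *)
pose cd k : ('I_n.+1 -> R) * ('I_n.+1 -> R) :=
  if unpickle k is Some cd then
    if asbool (cbox (lo cd) (hi cd) `<=` U) then (lo cd, hi cd) else (cst 1, cst 0)
  else (cst 1, cst 0).
have cbox10 : cbox (cst 1) (cst 0) `<=` U.
  by move=> x /(_ ord0) /andP[/le_trans/[apply]]; rewrite /cst ler10.
have cdU k : cbox (cd k).1 (cd k).2 `<=` U.
  by rewrite /cd; case: unpickle => [p|//]; case: asboolP.
exists (fun k => (cd k).1), (fun k => (cd k).2); split => //.
apply/seteqP; split => [x Ux|x [k _ /obox_cbox /cdU//]].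
have [p [xp pU]] := open_rat_box oU Ux.
by exists (pickle p) => //; rewrite /cd pickleK; case: asboolP.
Qed.

Lemma open_measurable_rV U : open U -> measurable U.
Proof.
move=> /open_bigcup_obox[c [d [_ ->]]].
by apply: bigcupT_measurable => k; exact: measurable_obox.
Qed.

Lemma continuous_measurable_rV (f : E -> R) (D : set E) :
  continuous f -> measurable_fun D (f : E -> measurableTypeR R).
Proof.
move=> cf; apply: (@measurable_funS _ _ _ _ setT) => //.
apply: (measurability _ (RGenOpens.measurableE R)) => _ [_ [a [b ->] <-]].
rewrite setTI; apply: open_measurable_rV.
by apply: open_comp => //; move=> x _; exact: cf.
Qed.

(** Dynkin's pi-lambda theorem: open boxes are stable under intersection and generate the Borel
    sets. *)
Lemma obox_induction (P : set E -> Prop) :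
  P setT -> (forall c d, P (obox c d)) ->
  (forall A, measurable A -> P A -> P (~` A)) ->
  (forall F : (set E)^nat, (forall k, measurable (F k)) -> trivIset setT F ->
    (forall k, P (F k)) -> P (\bigcup_k F k)) ->
  forall A, measurable A -> P A.
Proof.
move=> PT Pbox PC Pbigcup.
pose G := [set A : set E | exists c d, A = obox c d].
have GE : @measurable _ E = <<s G >>.
  apply/seteqP; split; last first.
    apply: smallest_sub; first exact: sigma_algebra_measurable.
    by move=> _ [c [d ->]]; exact: measurable_obox.
  apply: smallest_sub; first exact: smallest_sigma_algebra.
  rewrite -bigcup_seq; apply: bigcup_sub => i _ _ [B mB <-]; rewrite setTI.
  pose C := [set A : set R | <<s G >> ((fun x : E => x ord0 i) @^-1` A)].
  suff : @measurable _ (measurableTypeR R) `<=` C by move=> /(_ B mB).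
  rewrite [X in X `<=` _](RGenOpens.measurableE R); apply: smallest_sub.
    split=> [|A CA|F CF]; rewrite /C/=.
    - by rewrite preimage_set0; exact: sigma_algebra0.
    - by rewrite setTD -preimage_setC -setTD; apply: sigma_algebraCD.
    - by rewrite preimage_bigcup; exact: sigma_algebra_bigcup.
  move=> _ [a [b ->]]; rewrite /C/=.
  (* A slab in direction [i] is exhausted by boxes whose other sides are ]-k, k[. *)
  rewrite (_ : _ @^-1` _ = \bigcup_k obox
      (fun j => if j == i then a else - k%:R)
      (fun j => if j == i then b else k%:R)).
    by apply: sigma_algebra_bigcup => k; apply: sub_gen_smallest; eexists; eexists.
  apply/seteqP; split => [x /=|x /= [k _ /(_ i)]]; rewrite in_itv/=; last first.
    by rewrite eqxx.
  move=> abx; exists (Num.truncn (\sum_j `|x ord0 j|)).+1 => // j.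
  case: eqVneq => [-> //|_]; rewrite -ltr_norml.
  apply: (@le_lt_trans _ _ (\sum_j `|x ord0 j|)).
    by rewrite (bigD1 j)//= lerDl sumr_ge0.
  by rewrite truncnS_gt.
move=> A; rewrite [X in X A -> _]GE; move: A.
apply: dynkin_induction => //.
- move=> _ _ [c1 [d1 ->]] [c2 [d2 ->]].
  exists (fun i => Num.max (c1 i) (c2 i)), (fun i => Num.min (d1 i) (d2 i)).
  apply/seteqP; split => [x [h1 h2] i|x h]; last first.
    by split => i; have := h i; rewrite gt_max lt_min => /andP[/andP[a1 a2] /andP[b1 b2]]; apply/andP.
  by have /andP[a1 b1] := h1 i; have /andP[a2 b2] := h2 i; rewrite gt_max lt_min a1 a2 b1 b2.
- by move=> _ [c [d ->]].
Qed.

End boxes.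

(** * Hyperplanes are null sets *)

Section null_sets.
Context (R : realType).

Lemma measurable_dot n (u : 'rV[R]_n) :
  measurable_fun setT (dot u : 'rV[R]_n -> measurableTypeR R).
Proof.
apply: (@measurable_sum _ _ R setT _ _ (fun i (x : 'rV[R]_n) => u ord0 i * x ord0 i)) => i.
apply: measurable_funM => //; exact: measurable_coord.
Qed.

Lemma measurable_hyperplane n (u : 'rV[R]_n) (b : R) :
  measurable [set x | dot u x = b].
Proof.
rewrite -[X in measurable X]setTI.
exact: (measurable_dot u measurableT (measurable_set1 b)).
Qed.

(** By Fubini and induction on the dimension: the slice over a first coordinate [t] is again a
    hyperplane, unless the remaining part [u'] of the normal is zero. In that case the hyperplane is
    a point times the whole space, and the measure 0 of the point annihilates the second factor even
    if it is infinite. *)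
Lemma hyperplane_null n (u : 'rV[R]_n) (b : R) : u != 0 ->
  lebesgue_rV R n [set x | dot u x = b] = 0%E.
Proof.
elim: n u b => [|n IH] u b u0.
  by case/negP: u0; apply/eqP/rowP => -[].
pose u' : 'rV[R]_n := \row_j u ord0 (lift ord0 j).
have dotE t (y : 'rV[R]_n) :
    dot u (cons_rV (t, y)) = u ord0 ord0 * t + dot u' y.
  rewrite /dot big_ord_recl mxE unlift_none; congr (_ + _).
  by apply: eq_bigr => j _; rewrite !mxE liftK.
rewrite /= /lebesgue_rV_step /pushforward /product_measure1.
have [u'0|u'0] := eqVneq u' 0; last first.
  apply: integral0_eq => t _ /=.
  rewrite (_ : xsection _ _ = [set y | dot u' y = b - u ord0 ord0 * t]) ?IH//.
  apply/seteqP; split => y; rewrite /xsection /= inE /= dotE.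
    by move=> <-; rewrite addrAC subrr add0r.
  by move=> ->; rewrite addrC subrK.
have u00 : u ord0 ord0 != 0.
  apply: contra u0 => /eqP u00; apply/eqP/rowP => i; rewrite mxE.
  case: (unliftP ord0 i) => [j ->|-> //].
  by have /rowP/(_ j) := u'0; rewrite !mxE.
rewrite -/(product_measure1 _ _ _).
rewrite (_ : _ @^-1` _ = [set (u ord0 ord0)^-1 * b] `*` setT).
  by rewrite product_measure1E// [X in (X * _)%E](lebesgue_measure_set1) mul0e.
have dot0 (y : 'rV[R]_n) : dot u' y = 0.
  by rewrite u'0 /dot big1// => i _; rewrite mxE mul0r.
apply/seteqP; split => [[t y]|[t y]] /=; rewrite dotE dot0 addr0.
  by move=> <-; rewrite mulKf.
by move=> [-> _]; rewrite mulVKf.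
Qed.

End null_sets.

(** * Simplices: hyperplanes, barycentric coordinates and null boundaries *)

Lemma continuous_sumr (R : realType) (T : topologicalType) (I : Type)
    (s : seq I) (f : I -> T -> R) :
  (forall i, continuous (f i)) -> continuous (fun x => \sum_(i <- s) f i x).
Proof.
move=> cf; elim: s => [|i s IH] x.
  rewrite (_ : (fun x => _) = cst 0); first exact: cvg_cst.
  by apply/funext => y; rewrite big_nil.
rewrite (_ : (fun x => _) = f i \+ (fun x => \sum_(i <- s) f i x)).
  by apply: continuousD; [exact: cf|exact: IH].
by apply/funext => y; rewrite big_cons.
Qed.

Lemma exists_left_kernel (F : fieldType) m k (A : 'M[F]_(m, k)) :
  (k < m)%N -> exists2 w : 'rV_m, w != 0 & w *m A = 0.
Proof.
move=> km; have /rowV0Pn[w /sub_kermxP wA w0] : kermx A != 0.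
  rewrite kermx_eq0 /row_free; apply: contraTneq km => <-.
  by rewrite -leqNgt rank_leq_col.
by exists w.
Qed.

Section hulls.
Context (R : realType) (n : nat).
Local Notation E := 'rV[R]_n.+1.
Local Notation leb := (lebesgue_rV R n.+1).

Lemma continuous_dot (u : E) : continuous (dot u).
Proof.
apply: continuous_sumr => i x; apply: continuousM; first exact: cst_continuous.
exact: coord_continuous.
Qed.

Lemma continuous_dotr (u : E) : continuous (fun x : E => dot x u).
Proof.
apply: continuous_sumr => i x; apply: continuousM; last exact: cst_continuous.
exact: coord_continuous.
Qed.

Context (I : finType) (p : I -> E).
Implicit Types s : {set I}.

(** The columns of [A] are (-1, p a), so a left kernel vector (b, u) is the equation of a hyperplane
    through all the points; it exists since there are fewer columns than rows. *)
Lemma negligible_hull s : (#|s| <= n.+1)%N -> leb.-negligible (hull p s).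
Proof.
move=> sn.
pose A : 'M[R]_(1 + n.+1, #|s|) :=
  \matrix_(i, j) (row_mx (const_mx (-1)) (p (enum_val j)) : 'rV_(1 + n.+1)) ord0 i.
have [//|w w0 wA] := @exists_left_kernel _ _ _ A.
pose u : E := rsubmx w; pose b := lsubmx w ord0 ord0.
have ub a : a \in s -> dot u (p a) = b.
  have A0 j : A (lshift n.+1 ord0) j = - 1 by rewrite mxE (@row_mxEl _ 1 1) mxE.
  have A1 i j : A (rshift 1 i) j = p (enum_val j) ord0 i.
    by rewrite mxE (@row_mxEr _ 1 1).
  move=> sa; have /rowP/(_ (enum_rank_in sa a)) := wA.
  rewrite [LHS]mxE [RHS]mxE (@big_split_ord _ _ _ 1) /= big_ord1 A0 mulrN1.
  rewrite addrC => /subr0_eq h; rewrite /b mxE -h; apply: eq_bigr => i _.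
  by rewrite A1 mxE enum_rankK_in.
have hull_dot x : hull p s x -> dot u x = b.
  move=> [c [_ c1 ->]]; rewrite -[RHS]mul1r -c1 mulr_suml /dot.
  under eq_bigr do rewrite summxE mulr_sumr.
  rewrite exchange_big; apply: eq_bigr => a sa; rewrite -(ub _ sa) /dot mulr_sumr.
  by apply: eq_bigr => i _; rewrite [(c a *: p a) ord0 i]mxE mulrCA.
(* If [u = 0], a point of the hull would force [b = 0], hence [w = 0]; the hull is then empty. *)
have [u0|u0] := eqVneq u 0.
  apply: negligibleS (negligible_set0 _) => x hx.
  have b0 : b = 0 by rewrite -(hull_dot _ hx) u0 /dot big1// => i _; rewrite mxE mul0r.
  case/negP: w0; apply/eqP/rowP => i; rewrite [RHS]mxE.
  case: (@split_ordP 1 n.+1 i) => k ->.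
    by rewrite (ord1 k) -[RHS]b0 /b mxE.
  by move/rowP: u0 => /(_ k); rewrite !mxE.
exists [set x | dot u x = b]; split; [exact: measurable_hyperplane|exact: hyperplane_null|exact: hull_dot].
Qed.

(** Barycentric coordinates with respect to [n.+2] affinely independent points are defined on the
    whole space and are continuous, so they stay positive near a point at which all of them are
    positive. *)
Lemma interior_hull s (w : I -> R) : #|s| = n.+2 -> affinely_independent p s ->
  (forall a, a \in s -> 0 < w a) -> \sum_(a in s) w a = 1 ->
  (hull p s)° (\sum_(a in s) w a *: p a).
Proof.
move=> sn ind w0 w1.
(* Row [j] is (1, p_j), so [c *m M] records the total weight and the weighted point. Affine
   independence is freeness of the rows; as [M] is square in size, [pinvmx M] then computes
   barycentric coordinates. *)
pose M : 'M[R]_(#|s|, 1 + n.+1) :=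
  \matrix_j row_mx (const_mx 1) (p (enum_val j)).
have mulM (c : 'rV[R]_#|s|) : c *m M =
    row_mx (\sum_j c ord0 j)%:M (\sum_j c ord0 j *: p (enum_val j)).
  apply/rowP => k; rewrite [LHS]mxE; case: (@split_ordP 1 n.+1 k) => i ->.
    rewrite (@row_mxEl _ 1 1) mxE (ord1 i) mulr1n; apply: eq_bigr => j _.
    by rewrite mxE (@row_mxEl _ 1 1) mxE mulr1.
  rewrite (@row_mxEr _ 1 1) summxE; apply: eq_bigr => j _.
  by rewrite mxE (@row_mxEr _ 1 1) [RHS]mxE.
have Mfree : row_free M.
  rewrite -kermx_eq0; apply/eqP/row_matrixP => k; rewrite row0.
  set c : 'rV_#|s| := row k _.
  have : c *m M = row_mx 0 0 by rewrite -row_mul mulmx_ker row0 (@row_mx0 _ 1 1 n.+1).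
  rewrite mulM => /(@eq_row_mx _ 1 1 n.+1)[h1 h2].
  pose d a := if a \in s =P true is ReflectT sa then c ord0 (enum_rank_in sa a) else 0.
  have dE j : d (enum_val j) = c ord0 j.
    rewrite /d; case: eqP => [sa|]; first by rewrite enum_valK_in.
    by rewrite enum_valP.
  apply/rowP => j; rewrite [RHS]mxE -dE; apply: (ind d); last exact: enum_valP.
    rewrite big_enum_val; under eq_bigr do rewrite dE.
    by move/matrixP: h1 => /(_ ord0 ord0); rewrite !mxE eqxx.
  by rewrite big_enum_val; under eq_bigr do rewrite dE.
have Mfull : row_full M by rewrite /row_full (eqP Mfree) sn.
pose c (y : E) := row_mx 1%:M y *m pinvmx M.
have cK y : \sum_j c y ord0 j = 1 /\ y = \sum_j c y ord0 j *: p (enum_val j).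
  have := mulM (c y); rewrite [X in X = _]mulmxKpV ?submx_full//.
  move=> /(@eq_row_mx _ 1 1)[/matrixP/(_ ord0 ord0) h1 h2]; split => //.
  by move: h1; rewrite [X in X = _ -> _]mxE [X in _ = X -> _]mxE !mulr1n => ->.
have cC j : continuous (fun y => c y ord0 j).
  pose q : E := \row_i pinvmx M (rshift 1 i) j.
  rewrite (_ : (fun y => _) = fun y => pinvmx M (lshift n.+1 ord0) j + dot q y).
    move=> y; apply: continuousD; first exact: cst_continuous.
    exact: continuous_dot.
  apply/funext => y; rewrite mxE big_split_ord big_ord1 /= (@row_mxEl _ 1 1) mxE mul1r.
  by congr (_ + _); apply: eq_bigr => i _; rewrite (@row_mxEr _ 1 1) [q _ _]mxE mulrC.
set x : E := \sum_(a in s) _.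
have cx j : 0 < c x ord0 j.
  suff -> : c x ord0 j = w (enum_val j) by rewrite w0// enum_valP.
  pose wr : 'rV[R]_#|s| := \row_j w (enum_val j).
  suff -> : c x = wr by rewrite mxE.
  rewrite -[RHS]mulmx1 -(mulmxVp Mfree) mulmxA mulM; congr (row_mx _ _ *m _).
    by under eq_bigr do rewrite mxE; rewrite -big_enum_val w1.
  by under eq_bigr do rewrite mxE; rewrite -(big_enum_val (fun a => w a *: p a)).
have cnear j : \forall y \near (x : E), 0 < c y ord0 j.
  by move: (cC j x) => /cvgr_gt; apply; exact: cx.
apply: (filterS _ (filter_forall (nbhs_filter x) cnear)) => y y0.
have [y1 ye] := cK y.
pose d a := \sum_(j | enum_val j == a) c y ord0 j.
have dE j : d (enum_val j) = c y ord0 j.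
  by rewrite /d (big_pred1 j)// => i; rewrite (inj_eq enum_val_inj).
exists d; split.
- by move=> a; apply: sumr_ge0 => j _; exact: ltW.
- by rewrite big_enum_val; under eq_bigr do rewrite dE.
- by rewrite big_enum_val; under eq_bigr do rewrite dE.
Qed.

(** A point of the hull that is not interior has a vanishing barycentric coordinate, so it lies on a
    facet, spanned by only [n.+1] points. *)
Lemma negligible_hull_boundary s : #|s| = n.+2 -> affinely_independent p s ->
  leb.-negligible (hull p s `\` (hull p s)°).
Proof.
move=> sn ind.
apply: (@negligibleS _ _ _ _ (\bigcup_(a in [set` s]) hull p (s :\ a))).
  move=> x [[w [w0 w1 xE]] nx]; apply: contrapT => nsub; apply: nx.
  rewrite xE; apply: interior_hull => // a sa.
  rewrite lt_neqAle w0 andbT; apply/eqP => wa; apply: nsub; exists a => //.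
  exists w; split => //.
    by rewrite -w1 [RHS](big_setD1 a)//= -wa add0r.
  by rewrite xE [LHS](big_setD1 a)//= -wa scale0r add0r.
(* The facets are reindexed by natural numbers in order to use countable subadditivity. *)
rewrite bigcup_mkcond.
have [e eK] : exists e : I -> nat, injective e.
  by exists (fun a => enum_rank a : nat) => a b /val_inj/enum_rank_inj.
apply: (@negligibleS _ _ _ _ (\bigcup_k
    [set x | exists a, [/\ a \in s, e a = k & hull p (s :\ a) x]])).
  move=> x [a _]; case: ifPn => // sa hx; exists (e a) => //.
  by exists a; split => //; move: sa; rewrite inE.
apply: negligible_bigcup => k.
have [[a [sa ek]]|no] := pselect (exists a, a \in s /\ e a = k).
  apply: (negligibleS _ (@negligible_hull (s :\ a) _)).
    by move=> x [b [_ ebk hb]]; have -> : a = b by apply: eK; rewrite ek.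
  by have := cardsD1 a s; rewrite sa sn add1n => -[<-].
rewrite (_ : mkset _ = set0); first exact: negligible_set0.
by apply/seteqP; split => // x [a [sa ek _]]; apply: no; exists a.
Qed.

End hulls.

(** * Interiors of cells lie in the domain *)

Section lipschitz_domains.
Context (R : realType) (n : nat).
Local Notation E := 'rV[R]_n.+1.
Local Notation leb := (lebesgue_rV R n.+1).

Lemma continuous_enorm : continuous (@enorm R n.+1).
Proof.
move=> x; apply: (@continuous_comp _ _ _ (fun x : E => dot x x) Num.sqrt).
  apply: continuous_sumr => i y.
  by apply: continuousM; exact: coord_continuous.
exact: sqrt_continuous.
Qed.

Lemma dotDl (x y u : E) : dot (x + y) u = dot x u + dot y u.
Proof. by rewrite /dot -big_split; apply: eq_bigr => i _; rewrite mxE mulrDl. Qed.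

Lemma dotZl (a : R) (x u : E) : dot (a *: x) u = a * dot x u.
Proof. by rewrite /dot mulr_sumr; apply: eq_bigr => i _; rewrite mxE mulrA. Qed.

Lemma dotNl (x u : E) : dot (- x) u = - dot x u.
Proof. by rewrite -scaleN1r dotZl mulN1r. Qed.

Lemma dotBl (x y u : E) : dot (x - y) u = dot x u - dot y u.
Proof. by rewrite dotDl dotNl. Qed.

Lemma enormZ (a : R) (x : E) : enorm (a *: x) = `|a| * enorm x.
Proof.
rewrite /enorm -sqrtr_sqr -sqrtrM ?sqr_ge0//; congr Num.sqrt.
by rewrite /dot mulr_sumr; apply: eq_bigr => i _; rewrite mxE; ring.
Qed.

(* Just below the graph no point of [D] is nearby, so a point of the boundary
   is not interior to the closure. *)
Lemma lipschitz_interior_closure (D : set E) : lipschitz_boundary D ->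
  (closure D)° `<=` D.
Proof.
move=> lipD x0 ix0; apply: contrapT => nDx0.
have [|e [g [L [rho [e1 rho0 lipg graphD]]]]] := lipD x0.
  by split=> //; exact: interior_subset ix0.
pose P x := x - dot x e *: e.
have ee : dot e e = 1.
  by rewrite -[LHS]sqr_sqrtr ?[Num.sqrt _]e1 ?expr1n// sumr_ge0// => i _; rewrite sqr_ge0.
have P0 x : dot (P x) e = 0 by rewrite dotBl dotZl ee mulr1 subrr.
have x0g : dot x0 e <= g (P x0).
  rewrite leNgt; apply/negP => h; apply: nDx0; apply/graphD => //.
  by rewrite subrr /enorm /dot big1 ?sqrtr0// => i _; rewrite mxE mul0r.
have cvgx0 : x0 - t *: e @[t --> 0^'+] --> x0.
  rewrite -[X in _ --> X]subr0 -(scale0r e); apply: cvgB; first exact: cvg_cst.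
  apply: (@cvgZr_tmp _ _ _ _ _ (fun t : R => t) 0 e).
  by apply: cvg_at_right_filter; exact: cvg_id.
have [t [t0 trho cDt]] : exists t : R, [/\ 0 < t, t < rho & closure D (x0 - t *: e)].
  apply: (@filter_ex _ (0^'+)); near=> t; split.
  - by near: t; exact: nbhs_right_gt.
  - by near: t; exact: nbhs_right_lt.
  - by near: t; exact: (cvgx0 _ ix0).
set y := x0 - t *: e in cDt.
have ye : dot y e = dot x0 e - t by rewrite dotBl dotZl ee mulr1.
have Py : P y = P x0.
  by rewrite /P ye /y -addrA -opprD -scalerDl (addrC t) subrK.
have near1 : \forall z \near y, enorm (z - x0) < rho.
  have c : continuous (fun z : E => enorm (z - x0)).
    move=> z; apply: (@continuous_comp _ _ _ (fun z : E => z - x0) (@enorm R n.+1)).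
      by apply: continuousB; [exact: cvg_id|exact: cst_continuous].
    exact: continuous_enorm.
  move: (c y) => /cvgr_lt; apply.
  by rewrite /y addrAC subrr add0r -scaleNr enormZ e1 mulr1 normrN gtr0_norm.
(* The point [y] lies at least [t] below the graph; the left-hand side bounds the part of this
   margin that is lost on moving from [y] to [z]. *)
have near2 : \forall z \near y, L * enorm (P z - P y) + (dot z e - dot y e) < t.
  have c : continuous (fun z : E => L * enorm (P z - P y) + (dot z e - dot y e)).
    move=> z; apply: (@continuousD _ _ _ (fun z : E => L * enorm (P z - P y))
      (fun z : E => dot z e - dot y e)); last first.
      by apply: (@continuousB _ _ _ (fun z : E => dot z e)); [exact: continuous_dotr|exact: cst_continuous].
    apply: (@continuousM _ _ (cst L)); first exact: cst_continuous.
    apply: (@continuous_comp _ _ _ (fun z : E => P z - P y) (@enorm R n.+1));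
      last exact: continuous_enorm.
    apply: continuousB; last exact: cst_continuous.
    apply: continuousB; first exact: cvg_id.
    by apply: continuousZr_tmp; exact: continuous_dotr.
  move: (c y) => /cvgr_lt; apply.
  by rewrite !subrr addr0 /enorm /dot big1 ?sqrtr0 ?mulr0// => i _; rewrite mxE mul0r.
have [z [Dz [z1 z2]]] := cDt _ (filterI near1 near2).
move: Dz => /(graphD _ z1); rewrite -/(P z) => gz.
have := lipg _ _ (P0 z) (P0 y); rewrite Py in z2 *.
rewrite ler_distl => /andP[gPz _]; move: z2 gz x0g gPz; rewrite ye.
lra.
Unshelve. all: by end_near. Qed.

(** The cells cover the closure of [D], so the interior of a cell is a priori only inside the
    interior of that closure. For a slit domain this is larger than [D]; a Lipschitz boundary
    excludes slits. *)
Lemma mesh_cell_interior (D : set E) (Th : mesh D) (T : set E) :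
  lipschitz_boundary D -> cell Th T ->
  T° `<=` D /\ leb.-negligible (T `\` T°).
Proof.
case: Th => I p cs cs_simplex cs_cover ? lipD [s /= sc ->]; split.
  apply: subset_trans (lipschitz_interior_closure lipD).
  by apply: interiorS; rewrite cs_cover; apply: bigcup_sup.
by have [sn ind] := cs_simplex _ sc; exact: negligible_hull_boundary.
Qed.

End lipschitz_domains.

(** * Smooth functions of one variable built from exp(-1/t), and bumps *)

Section flat_functions.
Context (R : realType).
Implicit Types (P : {poly R}) (s t : R).

(** The classical function exp(-1/t), extended by 0; the factor P(1/t) makes the family closed under
    differentiation. *)
Definition flat P t : R := if 0 < t then P.[t^-1] * expR (- t^-1) else 0.

Lemma flat_le0 P t : t <= 0 -> flat P t = 0.
Proof. by rewrite /flat leNgt => /negbTE ->. Qed.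

(** With N the size of P, |P(s)| grows at most like s^N, while exp(s) = exp(s/(N+1))^(N+1) is at
    least (s/(N+1))^(N+1), one power more. With s = 1/t this makes [flat P t] of order t at 0. *)
Lemma horner_expRN_bound P : exists C, forall s, 1 <= s ->
  `|P.[s]| * expR (- s) <= C * s^-1.
Proof.
pose N := size P; pose A := \sum_(i < N) `|P`_i|.
exists (A * N.+1%:R ^+ N.+1) => s s1.
have s0 : 0 < s by rewrite (lt_le_trans ltr01).
have PA : `|P.[s]| <= A * s ^+ N.
  rewrite horner_coef (le_trans (ler_norm_sum _ _ _))// mulr_suml.
  apply: ler_sum => i _; rewrite normrM ler_wpM2l// normrX (ger0_norm (ltW s0)).
  by rewrite ler_weXn2l// ltnW.
have eA : expR (- s) <= (N.+1%:R / s) ^+ N.+1.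
  rewrite expRN -[X in _ <= X ^+ _]invf_div exprVn lef_pV2 ?posrE ?expR_gt0//;
    last by rewrite exprn_gt0// divr_gt0.
  have -> : expR s = expR (s / N.+1%:R) ^+ N.+1.
    by rewrite -expRM_natl mulrC divfK// pnatr_eq0.
  rewrite ler_pXn2r ?nnegrE ?expR_ge0 ?divr_ge0 ?ltW//.
  by rewrite (lt_le_trans _ (expR_ge1Dx _))// ltrDr.
apply: le_trans (ler_pM (normr_ge0 _) (expR_ge0 _) PA eA) _.
rewrite -mulrA -[X in _ <= X]mulrA; apply: ler_wpM2l; first by rewrite sumr_ge0.
by rewrite expr_div_n mulrCA [s ^+ N.+1]exprSr invfM (mulrA (s ^+ N)) divff ?mul1r// expf_neq0// gt_eqF.
Qed.

Lemma flat_continuous0 P : flat P t @[t --> 0] --> 0.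
Proof.
have [C hC] := horner_expRN_bound P.
have C0 : 0 <= C.
  have := hC 1 (lexx _); rewrite invr1 mulr1; apply: le_trans.
  by rewrite mulr_ge0// expR_ge0.
apply/cvgrPdist_le => /= e e0; near=> t; rewrite sub0r normrN /flat.
have tlt1 : `|t| < 1 by near: t; exact: (@nbhs0_lt _ R).
have tlte : `|t| * C <= e.
  near: t; apply: filterS (@nbhs0_lt _ R (e / (C + 1)) _) => [x|].
    rewrite ltr_pdivlMr ?ltr_wpDl// => /ltW; apply: le_trans.
    by rewrite ler_wpM2l// lerDl.
  by rewrite divr_gt0// ltr_wpDl.
case: ifPn => t0; last by rewrite normr0 ltW.
rewrite gtr0_norm// in tlt1 tlte.
rewrite normrM (gtr0_norm (expR_gt0 _)); apply: le_trans tlte.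
by have := hC t^-1; rewrite invrK (mulrC C); apply; rewrite invf_ge1// ltW.
Unshelve. all: by end_near. Qed.

Lemma is_derive_flat P t :
  is_derive t 1 (flat P) (flat ('X^2 * (P - P^`())) t).
Proof.
have [t0|t0|->] := ltgtP t 0.
- rewrite flat_le0 ?ltW//; apply: (@near_eq_is_derive _ _ _ (cst 0)).
  by near=> x; rewrite flat_le0// ltW//; near: x; exact: lt_nbhsl.
- pose f : R -> R := (fun y => P.[y] * expR (- y)) \o (fun x => x^-1).
  apply: (@near_eq_is_derive _ _ _ f).
    near=> x; rewrite /f/= /flat ifT//.
    by near: x; exact: lt_nbhsr.
  have d1 (y : R) : is_derive y 1 (fun y => P.[y] * expR (- y))
      ((P^`() - P).[y] * expR (- y)).
    have dP := is_derive_poly P y.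
    have dE : is_derive y 1 (expR \o -%R) (expR (- y) * - 1).
      by apply: is_derive1_comp; exact: is_deriveN.
    have := is_deriveM dP dE; rewrite (_ : _ + _ = (P^`() - P).[y] * expR (- y)) //.
    by rewrite hornerD hornerN /GRing.scale /=; ring.
  have d2 : is_derive t 1 (fun x : R => x^-1) (- t ^- 2).
    by rewrite -[- _]mulr1; apply: is_deriveV => //; rewrite gt_eqF.
  have := is_derive1_comp (d1 t^-1) d2.
  rewrite (_ : _ * _ = flat ('X^2 * (P - P^`())) t) //.
  rewrite /flat t0 !hornerE; field.
  by rewrite gt_eqF.
(* At 0 the difference quotient of [flat P] is [flat ('X * P)], which tends to 0 by
   [flat_continuous0]. *)
- rewrite flat_le0//; apply/is_derive1_caratheodory; exists (flat ('X * P)).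
  split; last by rewrite flat_le0.
    move=> z; rewrite [flat P 0]flat_le0// !subr0 /flat; case: ifPn => z0.
      by rewrite !hornerE mulrAC -mulrA mulrACA mulVf ?mul1r ?gt_eqF// mulrC.
    by rewrite mul0r.
  suff : flat ('X * P) x @[x --> (0 : R)] --> flat ('X * P) 0 by [].
  by rewrite (flat_le0 _ (lexx 0)); exact: flat_continuous0.
Unshelve. all: by end_near. Qed.

(** A syntactic class closed under differentiation: membership stands for the existence and
    continuity of derivatives of all orders. *)
Inductive smooth1 : (R -> R) -> Prop :=
| smooth1_cst c : smooth1 (fun=> c)
| smooth1_flat P a b : smooth1 (fun t => flat P (a * t + b))
| smooth1D f g : smooth1 f -> smooth1 g -> smooth1 (fun t => f t + g t)
| smooth1M f g : smooth1 f -> smooth1 g -> smooth1 (fun t => f t * g t).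

Lemma smooth1_derive f : smooth1 f ->
  exists2 g, smooth1 g & forall t, is_derive t 1 f (g t).
Proof.
elim=> [c|P a b|{}f g _ [f' sf df] _ [g' sg dg]|{}f g sf0 [f' sf df] sg0 [g' sg dg]].
- by exists (fun=> 0); [exact: smooth1_cst|move=> t; exact: is_derive_cst].
- exists (fun t => a * flat ('X^2 * (P - P^`())) (a * t + b)).
    by apply: smooth1M; [exact: smooth1_cst|exact: smooth1_flat].
  move=> t; rewrite mulrC.
  have d : is_derive t 1 (fun t : R => a * t + b) a.
    have := is_deriveD (is_deriveZ a (is_derive_id t (1 : R))) (is_derive_cst b t 1).
    by rewrite addr0 /GRing.scale /= mulr1.
  exact: is_derive1_comp (is_derive_flat _ _) d.
- exists (fun t => f' t + g' t); first exact: smooth1D.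
  by move=> t; exact: is_deriveD.
- exists (fun t => f t * g' t + g t * f' t).
    by apply: smooth1D; exact: smooth1M.
  by move=> t; exact: is_deriveM.
Qed.

Lemma smooth1_continuous f : smooth1 f -> continuous f.
Proof.
move=> /smooth1_derive[g _ df] t.
by apply: differentiable_continuous; apply/derivable1_diffP; have [] := df t.
Qed.

(** The scale [k] serves the limit: as it grows, the bumps converge pointwise to the indicator of
    the open interval, staying between 0 and 1. *)
Definition bump1 (k : nat) (c d t : R) : R :=
  flat 1 (k%:R * (t - c)) * flat 1 (k%:R * (d - t)).

Lemma smooth1_bump1 k c d : smooth1 (bump1 k c d).
Proof.
rewrite (_ : bump1 k c d = fun t =>
  flat 1 (k%:R * t + - (k%:R * c)) * flat 1 (- k%:R * t + k%:R * d)).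
  by apply: smooth1M; exact: smooth1_flat.
by apply/funext => t; rewrite /bump1 mulrBr; congr (_ * flat 1 _); ring.
Qed.

Lemma bump1_out k c d t : ~~ (c < t < d) -> bump1 k c d t = 0.
Proof.
rewrite negb_and -!leNgt => /orP[tc|dt]; rewrite /bump1.
  by rewrite flat_le0 ?mul0r// mulr_ge0_le0// subr_le0.
by rewrite mulrC flat_le0 ?mul0r// mulr_ge0_le0// subr_le0.
Qed.

Lemma flat1_itv t : 0 <= flat 1 t <= 1.
Proof.
rewrite /flat; case: ifPn => t0; last by rewrite lexx ler01.
by rewrite hornerC mul1r expR_ge0 /= -expR0 ler_expR oppr_le0 invr_ge0 ltW.
Qed.

Lemma bump1_itv k c d t : 0 <= bump1 k c d t <= 1.
Proof.
have /andP[? ?] := flat1_itv (k%:R * (t - c)).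
have /andP[? ?] := flat1_itv (k%:R * (d - t)).
by rewrite /bump1 mulr_ge0//= mulr_ile1.
Qed.

Lemma cvg_flat1 x : 0 < x -> flat 1 (k%:R * x) @[k --> \oo] --> (1 : R).
Proof.
move=> x0.
have : (k%:R * x)^-1 @[k --> \oo] --> (0 : R).
  under eq_fun do rewrite invfM.
  rewrite (_ : 0 = 0 * x^-1 :> R); last by rewrite mul0r.
  apply: cvgMr_tmp.
  apply/cvgrVy; last first.
    rewrite (_ : unstable.inv_fun _ = fun k : nat => k%:R); first exact: cvgr_idn.
    by apply/funext => k; rewrite /= invrK.
  by near=> k; rewrite invr_gt0 ltr0n; near: k; exact: nbhs_infty_gt.
move=> h; have : expR (- (k%:R * x)^-1) @[k --> \oo] --> (1 : R).
  suff : expR (- (k%:R * x)^-1) @[k --> \oo] --> (expR (- 0) : R).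
    by rewrite oppr0 expR0.
  apply: continuous_cvg; first exact: continuous_expR.
  exact: cvgN h.
apply: cvg_trans; apply: near_eq_cvg; near=> k.
rewrite /flat ifT ?hornerC ?mul1r// mulr_gt0// ltr0n.
by near: k; exact: nbhs_infty_gt.
Unshelve. all: by end_near. Qed.

Lemma cvg_bump1 c d t : bump1 k c d t @[k --> \oo] --> ((c < t < d)%R%:R : R).
Proof.
have [/andP[ct td]|h] := boolP (c < t < d); last first.
  by under eq_fun do rewrite bump1_out//; exact: cvg_cst.
rewrite (_ : true%:R = 1 * 1 :> R); last by rewrite mulr1.
by apply: cvgM; apply: cvg_flat1; rewrite subr_gt0.
Qed.

End flat_functions.

(** * Products of one-variable functions over the coordinates *)

Section tensor_products.
Context (R : realType) (n : nat).
Local Notation E := 'rV[R]_n.+1.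
Implicit Types (h : 'I_n.+1 -> R -> R) (x : E).

Definition tens h x : R := \prod_i h i (x ord0 i).

(** A partial derivative of a product over the coordinates changes one factor only; [upd] expresses
    the result as a product of the same kind, so that derivatives can be iterated. *)
Definition upd h (i : 'I_n.+1) (g : R -> R) : 'I_n.+1 -> R -> R :=
  fun j => if j == i then g else h j.

Lemma is_derive_along_coord (f : E -> R) (g : R -> R) x i l :
  (forall s, f (s *: delta_mx ord0 i + x) = g (s + x ord0 i)) ->
  is_derive (x ord0 i) 1 g l ->
  is_derive x (delta_mx ord0 i) (f : E -> R^o) l.
Proof.
move=> fg [dg gl].
have E1 : (fun s : R => s^-1 *: (f (s *: delta_mx ord0 i + x) - f x)) =
          (fun s : R => s^-1 *: (g (s *: 1 + x ord0 i) - g (x ord0 i))).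
  apply/funext => s; rewrite fg [s *: 1]mulr1; congr (_ *: (_ - _)).
  by have := fg 0; rewrite scale0r !add0r.
by split; [rewrite /derivable E1|rewrite /derive E1].
Qed.

Lemma tens_upd h i g x :
  tens (upd h i g) x = g (x ord0 i) * \prod_(j | j != i) h j (x ord0 j).
Proof.
rewrite /tens (bigD1 i)//= /upd eqxx; congr (_ * _).
by apply: eq_bigr => j /negbTE ->.
Qed.

Lemma tens_split h i x :
  tens h x = h i (x ord0 i) * \prod_(j | j != i) h j (x ord0 j).
Proof. by rewrite /tens (bigD1 i). Qed.

Lemma is_derive_tens h i (g : R -> R) x : (forall t : R, is_derive t (1 : R) (h i) (g t)) ->
  is_derive x (delta_mx ord0 i) (tens h : E -> R^o) (tens (upd h i g) x).
Proof.
move=> dh; rewrite tens_upd.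
apply: (@is_derive_along_coord _
  (fun t => h i t * \prod_(j | j != i) h j (x ord0 j))).
  move=> s; rewrite (tens_split _ i) !mxE !eqxx mulr1; congr (_ * _).
  by apply: eq_bigr => j /negbTE ji; rewrite !mxE eqxx ji mulr0 add0r.
have := is_deriveM (dh (x ord0 i))
  (is_derive_cst (\prod_(j | j != i) h j (x ord0 j)) (x ord0 i) 1).
by rewrite scaler0 add0r [_ *: _]mulrC.
Qed.

Lemma partial_tens h i (g : R -> R) : (forall t : R, is_derive t (1 : R) (h i) (g t)) ->
  partial i (tens h) = tens (upd h i g).
Proof. by move=> dh; apply/funext => x; have [] := is_derive_tens x dh. Qed.

Lemma continuous_tens h : (forall i, continuous (h i)) -> continuous (tens h).
Proof.
move=> ch; rewrite /tens; elim: (index_enum _) => [|i s IH] x.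
  rewrite (_ : (fun x => _) = cst 1); first exact: cst_continuous.
  by apply/funext => y; rewrite big_nil.
rewrite (_ : (fun x => _) = (fun x : E => h i (x ord0 i)) \*
    (fun x : E => \prod_(i <- s) h i (x ord0 i))).
  apply: continuousM; last exact: IH.
  apply: (@continuous_comp _ _ _ (fun x : E => x ord0 i) (h i)).
    exact: coord_continuous.
  exact: ch.
by apply/funext => y; rewrite big_cons.
Qed.

Lemma smooth_tens h : (forall i, smooth1 (h i)) -> smooth (tens h).
Proof.
move=> + k; elim: k h => [|k IH] h sh.
  by apply: continuous_tens => i; exact: smooth1_continuous.
split; first by apply: continuous_tens => i; exact: smooth1_continuous.
move=> i; have [g sg dg] := smooth1_derive (sh i); split.
  by move=> x; have [] := is_derive_tens x dg.
rewrite (partial_tens dg); apply: IH => j; rewrite /upd.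
by case: ifP => // _; exact: sh.
Qed.

Definition bump (k : nat) (c d : 'I_n.+1 -> R) : E -> R :=
  tens (fun i => bump1 k (c i) (d i)).

Lemma bump_out k c d x : ~ obox c d x -> bump k c d x = 0.
Proof.
move=> ncd; apply/eqP/negPn/negP; rewrite prodf_seq_neq0 => /allP h.
apply: ncd => i; apply: contraT => ni; have := h i (mem_index_enum _).
by rewrite /= (bump1_out _ ni) eqxx.
Qed.

Lemma bump_support k c d : fun_support (bump k c d) `<=` cbox c d.
Proof.
have cl : closed (cbox c d) by apply: compact_closed; [exact: norm_hausdorff|exact: compact_cbox].
rewrite (closure_id (cbox c d)).1//; apply: closure_subset => x /= /eqP fx.
by apply: obox_cbox; apply: contrapT => /(bump_out k).
Qed.

Lemma test_function_bump (D : set E) k c d : cbox c d `<=` D ->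
  test_function D (bump k c d).
Proof.
move=> cD; split.
- by apply: smooth_tens => i; exact: smooth1_bump1.
- apply: (subclosed_compact _ (@compact_cbox _ _ c d) (@bump_support _ _ _)).
  exact: closed_closure.
- by apply: subset_trans cD; exact: bump_support.
Qed.

Lemma bump_itv01 k c d x : 0 <= bump k c d x <= 1.
Proof.
apply/andP; split; first by apply: prodr_ge0 => i _; have /andP[] := bump1_itv k (c i) (d i) (x ord0 i).
by apply: prodr_ile1 => i _; exact: bump1_itv.
Qed.

Lemma cvg_bump c d x : bump k c d x @[k --> \oo] --> (\1_(obox c d) x : R).
Proof.
have -> : \1_(obox c d) x = \prod_i ((c i < x ord0 i < d i)%R%:R : R).
  have [xcd|xcd] := pselect (obox c d x).
    by rewrite indicE mem_set// big1// => i _; rewrite xcd.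
  rewrite indicE memNset//; apply/esym/eqP; rewrite prodf_seq_eq0.
  apply/hasP; apply: contrapT => no; apply: xcd => i; apply: contraT => /negbTE ni.
  by case: no; exists i; rewrite ?mem_index_enum//= ni eqxx.
rewrite /bump /tens; elim: (index_enum _) => [|i s IH].
  by rewrite big_nil; under eq_fun do rewrite big_nil; exact: cvg_cst.
rewrite big_cons; under eq_fun do rewrite big_cons.
by apply: cvgM; [exact: cvg_bump1|exact: IH].
Qed.

End tensor_products.

(** * Fubini's theorem for products over the coordinates *)

Section integral_products.
Context (R : realType).
Local Open Scope ereal_scope.

Lemma integrable_tensor d1 d2 (T1 : measurableType d1) (T2 : measurableType d2)
    (m1 : {sigma_finite_measure set T1 -> \bar R})
    (m2 : {sigma_finite_measure set T2 -> \bar R}) (f : T1 -> R) (g : T2 -> R) :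
  m1.-integrable setT (EFin \o f) -> m2.-integrable setT (EFin \o g) ->
  (m1 \x m2).-integrable setT (fun z => (f z.1 * g z.2)%:E) /\
  \int[m1 \x m2]_z (f z.1 * g z.2)%:E =
    (\int[m1]_x (f x)%:E) * (\int[m2]_y (g y)%:E).
Proof.
move=> intf intg.
have mf : measurable_fun setT f by apply/measurable_EFinP; exact: measurable_int intf.
have mg : measurable_fun setT g by apply/measurable_EFinP; exact: measurable_int intg.
have mfg : measurable_fun setT (fun z : T1 * T2 => (f z.1 * g z.2)%:E).
  apply/measurable_EFinP; apply: measurable_funM.
    exact: (measurableT_comp mf measurable_fst).
  exact: (measurableT_comp mg measurable_snd).
have ifg : (m1 \x m2).-integrable setT (fun z => (f z.1 * g z.2)%:E).
  apply/integrableP; split => //.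
  rewrite fubini_tonelli1//; last exact: measurableT_comp.
  rewrite /fubini_F/=.
  under eq_integral => x _.
    under eq_integral do rewrite normrM EFinM.
    rewrite ge0_integralZl//; last first.
      by apply/measurable_EFinP; exact: measurableT_comp.
    over.
  rewrite ge0_integralZr//; last 2 first.
  - by apply/measurable_EFinP; exact: measurableT_comp.
  - exact: integral_ge0.
  have [_ fi] := integrableP _ _ _ intf; have [_ gi] := integrableP _ _ _ intg.
  by apply: lte_mul_pinfty => //; [exact: integral_ge0|rewrite ge0_fin_numE//; exact: integral_ge0].
split => //; rewrite -fubini1// /fubini_F/=.
under eq_integral => x _.
  under eq_integral do rewrite EFinM.
  rewrite integralZl//.
  over.
rewrite -(fineK (integral_fune_fin_num _ intg))//.
by rewrite integralZr.
Qed.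

(** [lebesgue_rV] is built recursively as the image under [cons_rV] of a product measure, so the
    first coordinate splits off at each step; in dimension 0 the empty product is integrated against
    a unit mass. *)
Lemma integrable_prod_coord n (h : 'I_n -> R -> R) :
  (forall i, (@lebesgue_measure R).-integrable setT (EFin \o h i)) ->
  (lebesgue_rV R n).-integrable setT (fun x => (\prod_i h i (x ord0 i))%:E) /\
  \int[lebesgue_rV R n]_x (\prod_i h i (x ord0 i))%:E =
  \prod_i \int[lebesgue_measure]_t (h i t)%:E.
Proof.
elim: n h => [|n IH] h ih.
  have e : (fun x : 'rV[R]_0 => (\prod_i h i (x ord0 i))%:E) = cst 1.
    by apply/funext => x; rewrite big_ord0.
  have m1 : lebesgue_rV R 0 setT = 1 by rewrite /= diracT.
  have ie : \int[lebesgue_rV R 0]_x (cst 1 x) = 1.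
    by rewrite (integral_cst _ measurableT) mul1e.
  rewrite e; split; last by rewrite ie big_ord0.
  apply/integrableP; split; first exact: measurable_cst.
  by under eq_integral do rewrite /= normr1; rewrite ie ltry.
have [i1 e1] := IH _ (fun j => ih (lift ord0 j)).
have [i2 e2] := integrable_tensor (ih ord0) i1.
pose F (x : 'rV[R]_n.+1) := (\prod_i h i (x ord0 i))%:E.
have FE z : F (cons_rV z) =
    (h ord0 z.1 * \prod_j h (lift ord0 j) (z.2 ord0 j))%:E.
  rewrite /F big_ord_recl mxE unlift_none; congr (_ * _)%:E.
  by apply: eq_bigr => j _; rewrite mxE liftK.
have mF : measurable_fun setT F.
  apply/measurable_EFinP; apply: measurable_prod => i _.
  apply: (measurableT_comp _ (measurable_coord i)).
  by apply/measurable_EFinP; exact: measurable_int (ih i).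
have mc := @measurable_cons_rV R n.
have iF : (@lebesgue_measure R \x lebesgue_rV R n).-integrable
    (@cons_rV R n @^-1` setT) (F \o @cons_rV R n).
  rewrite preimage_setT; apply: eq_integrable i2 => // z _.
  by rewrite /= FE.
split; first exact: (integrable_pushforward mc mF iF measurableT).
rewrite [LHS](integral_pushforward mc mF iF measurableT) preimage_setT.
rewrite big_ord_recl -e1 -e2; apply: eq_integral => z _.
by rewrite /= FE.
Qed.

End integral_products.

(** * Integration by parts of a polynomial against a bump *)

Section integration_by_parts.
Context (R : realType).

Lemma is_derive_zero_outside (f g : R -> R) (c d : R) :
  (forall t : R, is_derive t (1 : R) f (g t)) ->
  (forall t, ~~ (c < t < d) -> f t = 0) ->
  forall t, ~~ (c <= t <= d) -> g t = 0.
Proof.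
move=> df f0 t tcd.
suff [_ d0] : is_derive t (1 : R) f 0 by have [_ <-] := df t.
apply: (@near_eq_is_derive _ _ _ (cst 0)).
move: tcd; rewrite negb_and -!ltNge => /orP[tc|dt]; near=> s; rewrite /cst f0//.
  by rewrite negb_and -!leNgt ltW//; near: s; exact: lt_nbhsl.
rewrite negb_and -!leNgt (@ltW _ _ d) ?orbT//; near: s; exact: lt_nbhsr.
Unshelve. all: by end_near. Qed.

Lemma integrable_zero_outside (g : R -> R) (c d : R) : continuous g ->
  (forall t, ~~ (c <= t <= d) -> g t = 0) ->
  (@lebesgue_measure R).-integrable setT (EFin \o g).
Proof.
move=> cg g0.
have : (@lebesgue_measure R).-integrable setT ((EFin \o g) \_ `[c, d]).
  apply/(integrable_mkcond (mu := @lebesgue_measure R) (EFin \o g)) => //.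
  apply: continuous_compact_integrable; first exact: segment_compact.
  exact: continuous_subspaceT.
apply: eq_integrable => // t _.
by rewrite patchE; case: ifPn => //; rewrite notin_setE /= in_itv/= => /negP/g0 ->.
Qed.

Lemma integral_derive_zero_outside (f g : R -> R) (c d : R) :
  (forall t : R, is_derive t (1 : R) f (g t)) -> continuous g ->
  (forall t, ~~ (c < t < d) -> f t = 0) ->
  (\int[lebesgue_measure]_t (g t)%:E = 0)%E.
Proof.
move=> df cg f0; have g0 := is_derive_zero_outside df f0.
have cf : continuous f.
  by move=> t; apply: differentiable_continuous; apply/derivable1_diffP; have [] := df t.
have -> : (\int[lebesgue_measure]_t (g t)%:E =
           \int[lebesgue_measure]_(t in `[c, d]) (g t)%:E)%E.
  rewrite [RHS]integral_mkcond; apply: eq_integral => t _.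
  by rewrite patchE; case: ifPn => //; rewrite notin_setE /= in_itv/= => /negP/g0 ->.
have [cd|dc] := ltP c d; last first.
  move: dc; rewrite le_eqVlt => /orP[/eqP ->|dc].
    by rewrite set_itv1 integral_set1.
  by rewrite set_itv_ge ?integral_set0// bnd_simp -ltNge.
rewrite (continuous_FTC2 cd (F := f)).
- by rewrite !f0 ?subee// ?ltxx ?andbF.
- exact: continuous_subspaceT.
- split.
  + by move=> t _; have [] := df t.
  + exact: cvg_at_right_filter (cf c).
  + exact: cvg_at_left_filter (cf d).
- by move=> t _; rewrite derive1E; have [] := df t.
Qed.

Context (n : nat).
Local Notation E := 'rV[R]_n.+1.
Local Notation leb := (lebesgue_rV R n.+1).

Lemma partial_bump_out k (c d : 'I_n.+1 -> R) i x : ~ cbox c d x ->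
  partial i (bump k c d) x = 0.
Proof.
move=> xcd; have [g _ dg] := smooth1_derive (smooth1_bump1 k (c i) (d i)).
rewrite (partial_tens dg); apply/eqP/negPn/negP; rewrite prodf_seq_neq0 => /allP h.
apply: xcd => j; apply: contraT => nj; have := h j (mem_index_enum _).
rewrite /= /upd; case: (j =P i) => [ji|_].
  rewrite -ji in dg; rewrite (is_derive_zero_outside dg _ nj) ?eqxx// => t.
  exact: bump1_out.
rewrite bump1_out ?eqxx//; apply: contra nj => /andP[/ltW -> /ltW ->//].
Qed.

(* The integrand is the i-th partial derivative of [P * bump]. *)
Lemma integration_by_parts k (c d : 'I_n.+1 -> R) i (P : mpoly n.+1 R) :
  let F x := peval P x * partial i (bump k c d) x +
             peval (mderiv i P) x * bump k c d x in
  leb.-integrable setT (EFin \o F) /\ (\int[leb]_x (F x)%:E = 0)%E.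
Proof.
have [g sg dg] := smooth1_derive (smooth1_bump1 k (c i) (d i)).
(* By linearity it suffices to treat a monomial. Times the bump it is a product over the
   coordinates, and Fubini isolates the factor in direction [i]: the integral of [h'], the
   derivative of a function vanishing outside an interval. *)
elim/mpolyind: P => [|a m P mP a0 [iP eP]] F.
  have -> : F = cst 0.
    by apply/funext => x; rewrite /F mderiv0 /peval meval0 !mul0r addr0.
  by split; [exact: integrable0|exact: integral0].
pose h j t := t ^+ m j * bump1 k (c j) (d j) t.
pose h' t := t ^+ m i * g t + bump1 k (c i) (d i) t * ((m i)%:R * t ^+ (m i).-1).
have dh t : is_derive t (1 : R) (h i) (h' t).
  have dX : is_derive t (1 : R) (fun t : R => t ^+ m i) ((m i)%:R * t ^+ (m i).-1).
    have := is_derive_poly 'X^(m i) t.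
    rewrite derivXn hornerMn hornerXn -mulr_natl.
    by rewrite (_ : horner _ = fun t : R => t ^+ m i)//; apply/funext => s; rewrite hornerXn.
  exact: (is_deriveM dX (dg t)).
have ch' : continuous h'.
  have cX p : continuous (fun t : R => t ^+ p) by move=> t; exact: exprn_continuous.
  move=> t; apply: (@continuousD R R R (fun t => t ^+ m i * g t)
    (fun t => bump1 k (c i) (d i) t * ((m i)%:R * t ^+ (m i).-1))).
    by apply: continuousM; [exact: cX|exact: smooth1_continuous].
  apply: (@continuousM _ _ (bump1 k (c i) (d i))).
    exact: smooth1_continuous (smooth1_bump1 _ _ _) _.
  by apply: (@continuousM _ _ (cst _)); [exact: cst_continuous|exact: cX].
have h0 j t : ~~ (c j < t < d j) -> h j t = 0.
  by move=> tcd; rewrite /h bump1_out// mulr0.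
have ih j : (@lebesgue_measure R).-integrable setT (EFin \o upd h i h' j).
  apply: (@integrable_zero_outside _ (c j) (d j)); rewrite /upd; case: (j =P i) => [ji|_].
  - exact: ch'.
  - move=> t; apply: (@continuousM R R (fun t => t ^+ m j) (bump1 k (c j) (d j))).
      exact: exprn_continuous.
    exact: smooth1_continuous (smooth1_bump1 _ _ _) _.
  - by rewrite ji; apply: (is_derive_zero_outside dh); exact: h0.
  - by move=> t tcd; apply: h0; apply: contra tcd => /andP[/ltW -> /ltW ->].
have [iM eM] := integrable_prod_coord ih.
have {}eM : (\int[leb]_x (tens (upd h i h') x)%:E = 0)%E.
  have I0 := integral_derive_zero_outside dh ch' (@h0 i).
  by rewrite [LHS]eM (bigD1 i)//= {1}/upd eqxx [X in (X * _)%E]I0 mul0e.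
have FE x : F x = a * tens (upd h i h') x +
    (peval P x * partial i (bump k c d) x + peval (mderiv i P) x * bump k c d x).
  have Xx : peval (mpolyX R m) x =
      x ord0 i ^+ m i * \prod_(j | j != i) x ord0 j ^+ m j.
    by rewrite /peval mevalX (bigD1 i).
  have X'x : peval (mderiv i (mpolyX R m)) x =
      (m i)%:R * x ord0 i ^+ (m i).-1 * \prod_(j | j != i) x ord0 j ^+ m j.
    rewrite /peval mderivX mevalZ mevalX (bigD1 i)//= -mulrA.
    congr (_ * (_ * _)); first by rewrite mnmBE mnm1E eqxx subn1.
    by apply: eq_bigr => j /negbTE ji; rewrite mnmBE mnm1E eq_sym ji subn0.
  rewrite /F mderivD mderivZ /peval !mevalD !mevalZ.
  rewrite -!/(peval _ _) Xx X'x (partial_tens dg) tens_upd tens_upd.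
  have bx := tens_split (fun j => bump1 k (c j) (d j)) i x.
  rewrite -[bump k c d x]/(tens (fun j => bump1 k (c j) (d j)) x) bx.
  set B := \prod_(j | j != i) bump1 k (c j) (d j) (x ord0 j).
  set A := \prod_(j | j != i) x ord0 j ^+ m j.
  have -> : \prod_(j | j != i) h j (x ord0 j) = A * B by rewrite -big_split.
  by rewrite /h'; ring.
split.
  have := integrableD measurableT (integrableZl measurableT a iM) iP.
  by apply: eq_integrable => // x _; rewrite /= FE.
transitivity (\int[leb]_x (a%:E * (tens (upd h i h') x)%:E +
  (peval P x * partial i (bump k c d) x + peval (mderiv i P) x * bump k c d x)%:E))%E.
  by apply: eq_integral => x _; rewrite FE.
rewrite integralD//; last exact: (integrableZl measurableT a iM).
by rewrite integralZl// eM eP mule0 adde0.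
Qed.

End integration_by_parts.

(** * Integrability and null functions in L^2 *)

Section L2_spaces.
Context (R : realType) (n : nat).
Local Notation E := 'rV[R]_n.+1.
Local Notation leb := (lebesgue_rV R n.+1).
Implicit Types (D : set E) (f g h : E -> R) (u v w : E -> E).

Lemma lebesgue_cbox_fin (c d : 'I_n.+1 -> R) : (leb (cbox c d) < +oo)%E.
Proof.
rewrite (_ : cbox c d =
    [set x | forall i, [set` `[c i, d i]] (x ord0 i)]); last first.
  by apply/seteqP; split => x /= h i; have := h i; rewrite in_itv.
rewrite (lebesgue_rV_box (A := fun i => [set` `[c i, d i]])); last first.
  by move=> i; exact: measurable_itv.
rewrite -ge0_fin_numE ?prode_ge0//; apply: prode_fin_num => i _.
by rewrite lebesgue_measure_itv/=; case: ifP.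
Qed.

Lemma bounded_set_cbox D : bounded_set D -> exists M : R, D `<=` cbox (cst (- M)) (cst M).
Proof.
move=> [M [Mr bD]]; exists (M + 1) => x Dx i.
rewrite -ler_norml; apply: le_trans (bD (M + 1) _ x Dx); last by rewrite ltrDl.
rewrite [leRHS]/Num.norm/= mx_normrE; apply/bigmax_geP; right => /=.
by exists (ord0, i).
Qed.

Lemma L2_mul_integrable D f g : measurable D -> L2 D f -> L2 D g ->
  leb.-integrable D (fun x => (f x * g x)%:E).
Proof.
move=> mD [mf if2] [mg ig2].
apply: (le_integrable mD _ _ (integrableD mD if2 ig2)).
  by apply/measurable_EFinP; exact: measurable_funM.
move=> x _ /=; rewrite lee_fin [leRHS]ger0_norm; last by rewrite addr_ge0// sqr_ge0.
rewrite normrM -(real_normK (num_real (f x))) -(real_normK (num_real (g x))).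
set a := `|f x|; set b := `|g x|.
have : 0 <= (a - b) ^+ 2 by exact: sqr_ge0.
have : 0 <= a * b by rewrite mulr_ge0// normr_ge0.
nra.
Qed.

Lemma continuous_integrable_cbox D (c d : 'I_n.+1 -> R) f : measurable D ->
  D `<=` cbox c d -> continuous f -> leb.-integrable D (EFin \o f).
Proof.
move=> mD Dcd cf.
have [M hM] : exists M, forall x, cbox c d x -> `|f x| <= M.
  have : compact (f @` cbox c d).
    apply: continuous_compact; last exact: compact_cbox.
    exact: continuous_subspaceT.
  move=> /compact_bounded[M [_ hM]]; exists (M + 1) => x xcd.
  by apply: (hM (M + 1)); [rewrite ltrDl|exists x].
apply: (@le_integrable _ _ _ _ _ mD _ (cst M%:E)).
- by apply/measurable_EFinP; exact: continuous_measurable_rV.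
- move=> x /Dcd /hM h /=; rewrite lee_fin; apply: le_trans h _; exact: ler_norm.
- apply/integrableP; split; first exact: measurable_cst.
  rewrite integral_cst// lte_mul_pinfty// ?lee_fin//.
  apply: le_lt_trans (lebesgue_cbox_fin c d); apply: le_measure; rewrite ?inE//.
  exact: measurable_cbox.
Qed.

Lemma continuous_L2 D f : measurable D -> bounded_set D -> continuous f -> L2 D f.
Proof.
move=> mD /bounded_set_cbox[M DM] cf; split; first exact: continuous_measurable_rV.
apply: (continuous_integrable_cbox mD DM) => x.
by apply: continuousM; exact: cf.
Qed.

Lemma L2_integrable D f : measurable D -> bounded_set D -> L2 D f ->
  leb.-integrable D (EFin \o f).
Proof.
move=> mD bD Lf; have L1 : L2 D (cst 1) by apply: continuous_L2 => //; exact: cst_continuous.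
by have := L2_mul_integrable mD Lf L1; apply: eq_integrable => // x _; rewrite /= mulr1.
Qed.

Lemma L2_sub D D' f : measurable D -> measurable D' -> D' `<=` D -> L2 D f -> L2 D' f.
Proof.
move=> mD mD' D'D [mf if2]; split; first exact: measurable_funS mf.
exact: integrableS if2.
Qed.

Lemma eq_ae_ip D f g h : measurable D -> L2 D f -> L2 D g -> L2 D h ->
  {ae leb, forall x, D x -> f x = g x} -> ip D f h = ip D g h.
Proof.
move=> mD [mf _] [mg _] [mh _] fg; congr fine; apply: ae_eq_integral => //.
- by apply/measurable_EFinP; exact: measurable_funM.
- by apply/measurable_EFinP; exact: measurable_funM.
- by apply: filterS fg => x + Dx => /(_ Dx) /= ->.
Qed.

Lemma ip_eq0 D f : measurable D -> L2 D f -> ip D f f = 0 ->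
  {ae leb, forall x, D x -> f x = 0}.
Proof.
move=> mD Lf; have iff := L2_mul_integrable mD Lf Lf; have [mf _] := Lf.
have mff := measurable_int _ iff.
move=> ff0; have : (\int[leb]_(x in D) `|(f x * f x)%:E| = 0)%E.
  rewrite -[RHS]/(0%:E) -ff0 /ip /Rintegral fineK ?integral_fune_fin_num//.
  by apply: eq_integral => x _; rewrite /= ger0_norm// -expr2 sqr_ge0.
move/(ae_eq_integral_abs leb mD mff); apply: filterS => x h Dx.
by have := h Dx => -[] /eqP; rewrite mulf_eq0 orbb => /eqP.
Qed.

End L2_spaces.

(** * Semi-inner products and the Cauchy-Schwarz inequality *)

Section semi_inner_products.
Context (R : realType) (X : lmodType R).
Implicit Types (S : set X) (B : X -> X -> R).

(** Definiteness is not demanded, since a function vanishing almost everywhere has norm 0 without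
    being 0. The axioms are relative to a set [S] because the forms are meaningful only on subsets
    of the space of all functions. *)
Record semi_inner S B : Prop := SemiInner {
  semi_inner0 : S 0;
  semi_innerS : forall a x y, S x -> S y -> S (a *: x + y);
  semi_innerC : forall x y, S x -> S y -> B x y = B y x;
  semi_innerL : forall a x y z, S x -> S y -> S z ->
    B (a *: x + y) z = a * B x z + B y z;
  semi_inner_ge0 : forall x, S x -> 0 <= B x x }.

Context (S : set X) (B : X -> X -> R) (SB : semi_inner S B).

Lemma semi_innerSZ a x : S x -> S (a *: x).
Proof. by move=> Sx; rewrite -[a *: x]addr0; apply: semi_innerS SB _ _ _ _ (semi_inner0 SB). Qed.

Lemma semi_innerSD x y : S x -> S y -> S (x + y).
Proof. by move=> Sx Sy; rewrite -[x]scale1r; exact: semi_innerS SB _ _ _ _ _. Qed.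

Lemma semi_innerSB x y : S x -> S y -> S (x - y).
Proof. by move=> Sx Sy; rewrite addrC -scaleN1r; exact: semi_innerS SB _ _ _ _ _. Qed.

Lemma semi_innerS_sum k (e : 'I_k -> X) (a : 'I_k -> R) :
  (forall i, S (e i)) -> S (\sum_i a i *: e i).
Proof.
move=> Se; elim/big_ind : _ => [|x y|i _]; [exact: semi_inner0 SB|exact: semi_innerSD|].
exact: semi_innerSZ.
Qed.

Lemma semi_inner0l x : S x -> B 0 x = 0.
Proof.
move=> Sx; have S0 := semi_inner0 SB; have := semi_innerL SB 1 S0 S0 Sx.
by rewrite scaler0 addr0 mul1r => /eqP; rewrite -subr_eq subrr eq_sym => /eqP.
Qed.

Lemma semi_innerZl a x y : S x -> S y -> B (a *: x) y = a * B x y.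
Proof.
move=> Sx Sy; rewrite -[a *: x]addr0 (semi_innerL SB)//; last exact: semi_inner0 SB.
by rewrite semi_inner0l// addr0.
Qed.

Lemma semi_innerDl x y z : S x -> S y -> S z -> B (x + y) z = B x z + B y z.
Proof. by move=> Sx Sy Sz; rewrite -[x in LHS]scale1r (semi_innerL SB)// mul1r. Qed.

Lemma semi_innerBl x y z : S x -> S y -> S z -> B (x - y) z = B x z - B y z.
Proof. by move=> Sx Sy Sz; rewrite addrC -scaleN1r (semi_innerL SB)// mulN1r addrC. Qed.

Lemma semi_inner_suml k (e : 'I_k -> X) (a : 'I_k -> R) z :
  (forall i, S (e i)) -> S z -> B (\sum_i a i *: e i) z = \sum_i a i * B (e i) z.
Proof.
move=> Se Sz; suff [_ ->] : S (\sum_i a i *: e i) /\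
    B (\sum_i a i *: e i) z = \sum_i a i * B (e i) z by [].
elim/big_rec2 : _ => [|i x y _ [Sx xy]]; first by rewrite semi_inner0l//; split => //; exact: semi_inner0 SB.
by rewrite (semi_innerL SB)// xy; split => //; exact: semi_innerS SB _ _ _ _ _.
Qed.

Lemma semi_inner_CS x y : S x -> S y -> B x y ^+ 2 <= B x x * B y y.
Proof.
move=> Sx Sy.
have q (a b : R) : 0 <= a ^+ 2 * B x x + 2 * (a * b) * B x y + b ^+ 2 * B y y.
  have Sax := semi_innerSZ a Sx; have Sby := semi_innerSZ b Sy.
  have Sz := semi_innerSD Sax Sby; have := semi_inner_ge0 SB Sz.
  rewrite semi_innerDl// (semi_innerC SB Sax Sz) (semi_innerC SB Sby Sz).
  rewrite !semi_innerDl// !semi_innerZl// (semi_innerC SB Sx Sax).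
  rewrite (semi_innerC SB Sy Sax) (semi_innerC SB Sx Sby) (semi_innerC SB Sy Sby).
  rewrite !semi_innerZl// (semi_innerC SB Sy Sx).
  by congr (_ <= _); ring.
have := semi_inner_ge0 SB Sx; rewrite le_eqVlt => /orP[/eqP x0|x0].
  suff -> : B x y = 0 by rewrite -x0 mul0r expr0n.
  (* A null vector is orthogonal to everything: otherwise the coefficient chosen below gives the
     quadratic form [q] the value -1. *)
  apply/eqP/negPn/negP => xy0.
  have := q (- (B y y + 1) / (2 * B x y)) 1; rewrite -x0 mulr0 add0r !mulr1 expr1n mul1r.
  suff -> : 2 * (- (B y y + 1) / (2 * B x y)) * B x y = - (B y y + 1).
    by rewrite opprD addrAC addNr add0r oppr_ge0 ler10.
  by field.
(* The minimizing choice, up to scaling, at which [q] becomes [B x x] times the Cauchy-Schwarz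
   defect. *)
have := q (- B x y) (B x x).
rewrite (_ : _ + _ = B x x * (B x x * B y y - B x y ^+ 2)); last by ring.
by rewrite pmulr_rge0// subr_ge0.
Qed.

Lemma semi_inner_norm_CS x y : S x -> S y ->
  `|B x y| <= Num.sqrt (B x x) * Num.sqrt (B y y).
Proof.
move=> Sx Sy; rewrite -sqrtrM ?(semi_inner_ge0 SB)// -sqrtr_sqr.
by rewrite ler_wsqrtr// semi_inner_CS.
Qed.

End semi_inner_products.

(** * Weak divergence of a field that is polynomial on a box *)

Section local_divergence.
Context (R : realType) (n : nat).
Local Notation E := 'rV[R]_n.+1.
Local Notation leb := (lebesgue_rV R n.+1).
Implicit Types (D : set E) (f g : E -> R) (v : E -> E).

Lemma continuous_peval (P : mpoly n.+1 R) : continuous (peval P).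
Proof.
rewrite (_ : peval P = fun x : E => \sum_(m <- msupp P)
    mcoeff m P * tens (fun i t => t ^+ m i) x).
  apply: continuous_sumr => m x.
  apply: (@continuousM _ _ (cst (mcoeff m P))); first exact: cst_continuous.
  by apply: continuous_tens => i t; exact: exprn_continuous.
by apply/funext => x; rewrite /peval mevalE.
Qed.

Lemma continuous_bump k (c d : 'I_n.+1 -> R) : continuous (bump k c d).
Proof. exact: (smooth_tens (fun i => smooth1_bump1 k (c i) (d i)) 0%N). Qed.

Lemma continuous_partial_bump k (c d : 'I_n.+1 -> R) i :
  continuous (partial i (bump k c d)).
Proof.
by have [_ /(_ i)[_]] := smooth_tens (fun i => smooth1_bump1 k (c i) (d i)) 1%N.
Qed.

Definition mdiv (P : 'I_n.+1 -> mpoly n.+1 R) : mpoly n.+1 R := \sum_i mderiv i (P i).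

Lemma peval_mdiv P x : peval (mdiv P) x = \sum_i peval (mderiv i (P i)) x.
Proof. by rewrite /peval /mdiv raddf_sum. Qed.

Section weak_divergence_box.
Context (D : set E) (v : E -> E) (g : E -> R).
Hypothesis mD : measurable D.
Hypotheses (Lv : L2v D v) (Lg : L2 D g) (vg : weak_div D v g).
Context (P : 'I_n.+1 -> mpoly n.+1 R) (c d : 'I_n.+1 -> R).
Hypothesis (cdD : cbox c d `<=` D).
Hypothesis (vP : {ae leb, forall x, cbox c d x ->
  forall i, v x ord0 i = peval (P i) x}).

Let B := cbox c d.
Let mB : measurable B := measurable_cbox c d.
Let h x := g x - peval (mdiv P) x.

Let cint f : continuous f -> leb.-integrable B (EFin \o f).
Proof. exact: continuous_integrable_cbox mB (@subset_refl _ B). Qed.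

Let bounded_B : bounded_set B.
Proof. by apply: compact_bounded; exact: compact_cbox. Qed.

Let LgB : L2 B g. Proof. exact: L2_sub Lg. Qed.

Let LP Q : L2 B (peval Q).
Proof. by apply: continuous_L2 => //; exact: continuous_peval. Qed.

Let ih : leb.-integrable B (EFin \o h).
Proof.
have := integrableB mB (L2_integrable mB bounded_B LgB) (cint (@continuous_peval (mdiv P))).
by apply: eq_integrable.
Qed.

Let Rint_restrict f : (forall x, ~ B x -> f x = 0) ->
  \int[leb]_(x in D) f x = \int[leb]_(x in B) f x.
Proof.
move=> f0; rewrite Rintegral_mkcond [RHS]Rintegral_mkcond; apply: eq_Rintegral => x _.
rewrite !patchE; case: ifPn => [xD|]; case: ifPn => //.
  by rewrite notin_setE => /f0 ->.
by rewrite inE => /cdD xD; rewrite notin_setE.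
Qed.

(** Two expressions for (v, grad b) are compared: the weak divergence gives -(g, b), and integration
    by parts of the polynomials that [v] equals on [B] gives -(mdiv P, b). *)
Let int_h_bump k c' d' : cbox c' d' `<=` B ->
  \int[leb]_(x in B) (h x * bump k c' d' x) = 0.
Proof.
move=> sB; set b := bump k c' d'.
have tb : test_function D b by apply: test_function_bump; exact: subset_trans sB cdD.
have b0 x : ~ B x -> b x = 0.
  by move=> nB; apply: bump_out => /obox_cbox /sB.
have db0 i x : ~ B x -> partial i b x = 0.
  by move=> nB; apply: partial_bump_out => /sB.
have cb : continuous b by exact: continuous_bump.
have cdb i : continuous (partial i b) by exact: continuous_partial_bump.
have Lb : L2 B b by exact: continuous_L2.
have Ldb i : L2 B (partial i b) by exact: continuous_L2.
have ibp i : ip B (peval (P i)) (partial i b) = - ip B (peval (mderiv i (P i))) b.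
  have [_ I0] := integration_by_parts k c' d' i (P i).
  apply/eqP; rewrite -subr_eq0 opprK /ip -RintegralD//; try exact: L2_mul_integrable.
  rewrite Rintegral_mkcond -[0]/(fine 0%E) -I0 /Rintegral; apply/eqP; congr fine.
  apply: eq_integral => x _; rewrite patchE; case: ifPn => //.
  by rewrite notin_setE => nB; rewrite -/b b0// db0// !mulr0 addr0.
have LvB i : L2 B (fun x => v x ord0 i) by exact: L2_sub (Lv i).
have lhs : ipv D v (grad b) = \sum_i ip B (peval (P i)) (partial i b).
  rewrite /ipv Rint_restrict; last first.
    by move=> x nB; rewrite /dot big1// => i _; rewrite mxE db0// mulr0.
  transitivity (\sum_i ip B (fun x => v x ord0 i) (partial i b)).
    rewrite /dot /ip; under eq_Rintegral do under eq_bigr do rewrite mxE.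
    elim: (index_enum _) => [|i s IH].
      under eq_Rintegral do rewrite big_nil.
      by rewrite big_nil Rintegral_cst// mul0r.
    under eq_Rintegral do rewrite big_cons.
    rewrite big_cons -IH RintegralD//; first exact: L2_mul_integrable.
    have : leb.-integrable B (fun x => \sum_(i <- s) (v x ord0 i * partial i b x)%:E).
      by apply: integrable_sum => // j _; exact: L2_mul_integrable.
    by apply: eq_integrable => // x _; rewrite /= sumEFin.
  apply: eq_bigr => i _; apply: eq_ae_ip => //.
  by apply: filterS vP => x + Bx => /(_ Bx) /(_ i).
have := vg tb; rewrite lhs; under eq_bigr do rewrite ibp.
rewrite sumrN => /oppr_inj; rewrite /ip (Rint_restrict (f := fun x => g x * b x)); last first.
  by move=> x nB; rewrite b0// mulr0.
move=> e; transitivity (ip B g b - ip B (peval (mdiv P)) b).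
  rewrite /ip -RintegralB//; try exact: L2_mul_integrable.
  by apply: eq_Rintegral => x _; rewrite /h mulrBl.
apply/eqP; rewrite subr_eq0 {1}/ip -e; apply/eqP.
rewrite /ip; under [RHS]eq_Rintegral do rewrite peval_mdiv mulr_suml.
elim: (index_enum _) => [|i s IH].
  under [RHS]eq_Rintegral do rewrite big_nil.
  by rewrite big_nil Rintegral_cst// mul0r.
under [RHS]eq_Rintegral do rewrite big_cons.
rewrite big_cons IH [RHS]RintegralD//; first exact: L2_mul_integrable.
have : leb.-integrable B (fun x => \sum_(i <- s) (peval (mderiv i (P i)) x * b x)%:E).
  by apply: integrable_sum => // j _; exact: L2_mul_integrable.
by apply: eq_integrable => // x _; rewrite /= sumEFin.
Qed.

(** Dominated convergence, with bound |h|: the bumps tend to the indicator of the open box. *)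
Let int_h_obox c' d' : cbox c' d' `<=` B ->
  (\int[leb]_(x in obox c' d') (h x)%:E = 0)%E.
Proof.
move=> sB; have mh : measurable_fun B h by apply/measurable_EFinP; exact: measurable_int ih.
have mb k : measurable_fun B (bump k c' d' : E -> R).
  by apply: continuous_measurable_rV; exact: continuous_bump.
have [] := @dominated_convergence _ _ _ leb B mB
  (fun k x => (h x * bump k c' d' x)%:E) (fun x => (h x * \1_(obox c' d') x)%:E)
  (fun x => `|(h x)%:E|%E).
- by move=> k; apply/measurable_EFinP; exact: measurable_funM.
- apply/measurable_EFinP; apply: measurable_funM => //.
  by apply: measurable_indic; exact: measurable_obox.
- apply: aeW => x _; apply: cvg_EFin; first exact: nearW.
  by apply: cvgM; [exact: cvg_cst|exact: cvg_bump].
- exact: integrable_abse ih.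
- apply: aeW => x k _; rewrite /= lee_fin normrM ler_piMr//.
  by have /andP[b0 b1] := bump_itv01 k c' d' x; rewrite ger0_norm.
move=> _ _; set I := (\int[leb]_(x in B) (h x * _)%:E)%E => cvgI.
have I0 : I = 0%E.
  suff z : (fun k => \int[leb]_(x in B) (h x * bump k c' d' x)%:E)%E = cst 0%E.
    by move: cvgI; rewrite z => cvgI; apply: (cvg_unique _ cvgI); [exact: ereal_hausdorff|exact: cvg_cst].
  apply/funext => k; rewrite -[LHS]fineK ?[fine _]int_h_bump//.
  apply: integral_fune_fin_num => //.
  have bb : [bounded bump k c' d' x | x in B].
    exists 1; split; first exact: num_real.
    move=> M M1 x _ /=; have /andP[b0 b1] := bump_itv01 k c' d' x.
    by rewrite ger0_norm// (le_trans b1)// ltW.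
  have := integrableMr mB (mb k) bb ih.
  by apply: eq_integrable => // x _; rewrite /= -EFinM mulrC.
rewrite -[RHS]I0 /I integral_mkcond [RHS]integral_mkcond; apply: eq_integral => x _.
rewrite !patchE indicE; case: ifPn => xo.
  by rewrite mulr1 mem_set//; apply: sB; apply: obox_cbox; move: xo; rewrite inE.
by case: ifPn => // _; rewrite mulr0.
Qed.

(** Integrals of [h] over subboxes vanish, hence over all Borel subsets of the box by the pi-lambda
    theorem, which forces [h = 0] almost everywhere. *)
Lemma weak_div_box : {ae leb, forall x, obox c d x -> g x = peval (mdiv P) x}.
Proof.
have mo : measurable (obox c d) by exact: measurable_obox.
have io : leb.-integrable (obox c d) (EFin \o h).
  by apply: integrableS ih => //; exact: obox_cbox.
have H A : measurable A -> (\int[leb]_(x in obox c d `&` A) (h x)%:E = 0)%E.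
  move: A; apply: obox_induction => [|c' d'|A mA IA|F mF tF IF].
  - by rewrite setIT; apply: int_h_obox.
  - rewrite (_ : _ `&` _ = obox (fun i => Num.max (c i) (c' i)) (fun i => Num.min (d i) (d' i))).
      apply: int_h_obox => x xB i; have := xB i.
      by rewrite ge_max le_min => /andP[/andP[-> _] /andP[-> _]].
    apply/seteqP; split=> [x [h1 h2] i|x hx].
      by have /andP[a1 b1] := h1 i; have /andP[a2 b2] := h2 i; rewrite gt_max lt_min a1 a2 b1 b2.
    by split => i; have := hx i; rewrite gt_max lt_min => /andP[/andP[a1 a2] /andP[b1 b2]]; apply/andP.
  - have mF : measurable_fun (obox c d `&` A `|` obox c d `\` A) (EFin \o h).
      by rewrite setUIDK; exact: measurable_int io.
    have := integral_setU leb (measurableI _ _ mo mA) (measurableD mo mA) mF.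
    have dj : [disjoint obox c d `&` A & obox c d `\` A].
      by apply/disj_setPS => x [[_ Ax] [_ nAx]]; exact: nAx.
    move=> /(_ dj); rewrite setUIDK (_ : integral _ _ _ = 0%E); last first.
      exact: int_h_obox.
    by rewrite [X in _ = (X + _)%E]IA add0e -setDE => <-.
  - rewrite setI_bigcupr integral_bigcup.
    + by rewrite eseries0// => k _ _; exact: IF.
    + by apply: trivIset_setIl.
    + by move=> k; exact: measurableI.
    + by apply: integrableS io => //; [apply: bigcupT_measurable => k; exact: measurableI|apply: bigcup_sub => k _; exact: subIsetl].
have : ae_eq leb (obox c d) (EFin \o h) (cst 0%E).
  apply: integral_ae_eq => // A Ao mA.
  by rewrite integral0 -(H _ mA); congr (integral _ _ _); rewrite setIidr.
apply: filterS => x hx /hx /= [] /eqP; rewrite subr_eq0 => /eqP //.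
Qed.

End weak_divergence_box.
End local_divergence.

(** * The L^2 products as semi-inner products *)

Section L2_semi_inner.
Context (R : realType) (n : nat).
Local Notation E := 'rV[R]_n.+1.
Local Notation leb := (lebesgue_rV R n.+1).
Context (D : set E) (mD : measurable D).

Lemma semi_inner_ip : semi_inner (@L2 R n.+1 D) (ip D).
Proof.
have SL a f g : L2 D f -> L2 D g -> L2 D (a *: f + g).
  move=> Lf Lg; have [mf if2] := Lf; have [mg ig2] := Lg.
  have mfg : measurable_fun D (a *: f + g).
    by apply: measurable_funD => //; apply: measurable_funM => //; exact: measurable_cst.
  split => //.
  (* The square of af + g is dominated by 2 a^2 f^2 + 2 g^2, the gap being (af - g)^2. *)
  have i1 := integrableZl mD (a ^+ 2 + a ^+ 2) if2.
  have i2 := integrableZl mD 2 ig2.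
  apply: (le_integrable mD _ _ (integrableD mD i1 i2)).
    by apply/measurable_EFinP; exact: measurable_funX.
  move=> x _ /=; rewrite lee_fin !ger0_norm ?sqr_ge0//; last first.
    by rewrite addr_ge0// mulr_ge0// ?addr_ge0// sqr_ge0.
  rewrite -subr_ge0 -[(a *: f + g) x]/(a * f x + g x).
  rewrite (_ : _ - _ = (a * f x - g x) ^+ 2) ?sqr_ge0//; ring.
split => //.
- split; first exact: measurable_cst.
  by apply: (eq_integrable mD (cst 0%E)) => [x _|]; [rewrite /= expr0n|exact: integrable0].
- by move=> f g _ _; apply: eq_Rintegral => x _; rewrite mulrC.
- move=> a f g h Lf Lg Lh.
  have ifh := L2_mul_integrable mD Lf Lh; have igh := L2_mul_integrable mD Lg Lh.
  rewrite /ip -(RintegralZl a mD ifh) -RintegralD//.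
    by apply: eq_Rintegral => x _; rewrite mulrDl mulrA.
  exact: (integrableZl mD a ifh).
- by move=> f Lf; apply: Rintegral_ge0 => x _; rewrite -expr2 sqr_ge0.
Qed.

Lemma ipvE (u v : E -> E) : L2v D u -> L2v D v ->
  ipv D u v = \sum_i ip D (fun x => u x ord0 i) (fun x => v x ord0 i).
Proof.
move=> Lu Lv; rewrite /ipv /dot /ip; elim: (index_enum _) => [|i s IH].
  under eq_Rintegral do rewrite big_nil.
  by rewrite big_nil Rintegral_cst// mul0r.
under eq_Rintegral do rewrite big_cons.
rewrite big_cons -IH RintegralD//; first exact: L2_mul_integrable.
have : leb.-integrable D (fun x => \sum_(i <- s) (u x ord0 i * v x ord0 i)%:E).
  by apply: integrable_sum => // j _; exact: L2_mul_integrable.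
by apply: eq_integrable => // x _; rewrite /= sumEFin.
Qed.

Lemma semi_inner_ipv : semi_inner (@L2v R n.+1 D) (ipv D).
Proof.
have I := semi_inner_ip.
have cZ a (u v : E -> E) i : (fun x => (a *: u + v) x ord0 i) =
    a *: (fun x => u x ord0 i) + (fun x => v x ord0 i).
  by apply/funext => x; rewrite -[(a *: u + v) x]/(a *: u x + v x) !mxE.
have SL a u v : L2v D u -> L2v D v -> L2v D (a *: u + v).
  by move=> Lu Lv i; rewrite cZ; exact: (semi_innerS I).
split => //.
- move=> i; rewrite (_ : (fun x => _) = 0); first exact: (semi_inner0 I).
  by apply/funext => x; rewrite -[(0 : E -> E) x]/(0 : E) mxE.
- move=> u v Lu Lv; rewrite !ipvE//; apply: eq_bigr => i _; exact: (semi_innerC I).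
- move=> a u v w Lu Lv Lw; rewrite !ipvE//; last exact: SL.
  rewrite mulr_sumr -big_split; apply: eq_bigr => i _.
  by rewrite cZ (semi_innerL I).
- by move=> u Lu; rewrite ipvE//; apply: sumr_ge0 => i _; exact: (semi_inner_ge0 I).
Qed.

Lemma ipv_eq0 (v : E -> E) : L2v D v -> ipv D v v = 0 ->
  {ae leb, forall x, D x -> v x = 0}.
Proof.
move=> Lv; rewrite ipvE// => /eqP; rewrite psumr_eq0; last first.
  by move=> i _; apply: (semi_inner_ge0 semi_inner_ip).
move=> /allP v0; have H i : {ae leb, forall x, D x -> v x ord0 i = 0}.
  by apply: ip_eq0 => //; apply/eqP; apply: v0; exact: mem_index_enum.
apply: filterS (filter_forall _ H) => x Hx Dx.
by apply/rowP => i; rewrite mxE Hx.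
Qed.

Lemma eq_ae_ipv (u v w : E -> E) : L2v D u -> L2v D v -> L2v D w ->
  {ae leb, forall x, D x -> u x = v x} -> ipv D u w = ipv D v w.
Proof.
move=> Lu Lv Lw uv; rewrite !ipvE//; apply: eq_bigr => i _.
by apply: eq_ae_ip => //; apply: filterS uv => x + Dx => /(_ Dx) ->.
Qed.

End L2_semi_inner.

(** * Uniqueness and linearity of the divergence; zero normal trace *)

Section divergence.
Context (R : realType) (n : nat).
Local Notation E := 'rV[R]_n.+1.
Local Notation leb := (lebesgue_rV R n.+1).
Context (D : set E) (oD : open D) (bD : bounded_set D).
Implicit Types (u v w : E -> E) (f g q : E -> R).

Let mD : measurable D := open_measurable_rV oD.
Let SI := semi_inner_ip mD.
Let SV := semi_inner_ipv mD.

Lemma smooth_L2v_grad f : smooth f -> L2v D (grad f).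
Proof.
move=> sf i; apply: continuous_L2 => //.
rewrite (_ : (fun x => _) = partial i f); last by apply/funext => x; rewrite mxE.
by have [_ /(_ i)[_]] := sf 1%N.
Qed.

Lemma smooth_L2 f : smooth f -> L2 D f.
Proof. by move=> sf; apply: continuous_L2 => //; exact: (sf 0%N). Qed.

Lemma weak_div_lin a u v g h : L2v D u -> L2v D v -> L2 D g -> L2 D h ->
  weak_div D u g -> weak_div D v h -> weak_div D (a *: u + v) (a *: g + h).
Proof.
move=> Lu Lv Lg Lh ug vh f tf; have [sf _ _] := tf.
have Lf := smooth_L2 sf; have Lgf := smooth_L2v_grad sf.
by rewrite (semi_innerL SV)// (semi_innerL SI)// ug// vh// mulrN opprD.
Qed.

(** An open set is a countable union of open boxes whose closed boxes it contains, and countably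
    many exceptional null sets form a null set. *)
Lemma weak_div_open v g (U : set E) (P : 'I_n.+1 -> mpoly n.+1 R) :
  open U -> U `<=` D -> L2v D v -> L2 D g -> weak_div D v g ->
  {ae leb, forall x, U x -> forall i, v x ord0 i = peval (P i) x} ->
  {ae leb, forall x, U x -> g x = peval (mdiv P) x}.
Proof.
move=> oU UD Lv Lg vg vP; have [c [d [cdU UE]]] := open_bigcup_obox oU.
have H k : {ae leb, forall x, obox (c k) (d k) x -> g x = peval (mdiv P) x}.
  apply: (@weak_div_box _ _ D v g mD Lv Lg vg P _ _ (subset_trans (cdU k) UD)).
  by apply: filterS vP => x + /cdU.
move/ae_foralln : H; apply: filterS => x Hx; rewrite UE => -[k _]; exact: Hx.
Qed.

(** Zero is a polynomial field, so the result on polynomial fields, taken on the whole of [D], also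
    supplies the uniqueness of weak divergences. *)
Lemma weak_div_ae0 v g : L2v D v -> L2 D g -> weak_div D v g ->
  {ae leb, forall x, D x -> v x = 0} -> {ae leb, forall x, D x -> g x = 0}.
Proof.
move=> Lv Lg vg v0.
have := @weak_div_open v g D (fun=> 0) oD (@subset_refl _ D) Lv Lg vg.
move=> h; apply: filterS (h _) => [x + Dx|]; last first.
  by apply: filterS v0 => x + Dx i => /(_ Dx) ->; rewrite /peval meval0 mxE.
move/(_ Dx) => ->; rewrite peval_mdiv big1// => i _.
by rewrite mderiv0 /peval meval0.
Qed.

Lemma divergenceP v : Hdiv D v -> L2 D (divergence D v) /\ weak_div D v (divergence D v).
Proof. by move=> [_ ex]; exact: (xgetPex (cst 0) ex). Qed.

Lemma L2_divergence v : Hdiv D v -> L2 D (divergence D v).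
Proof. by move=> /divergenceP[]. Qed.

Lemma divergence_unique v g : Hdiv D v -> L2 D g -> weak_div D v g ->
  {ae leb, forall x, D x -> divergence D v x = g x}.
Proof.
move=> Hv Lg vg; have [Ld vd] := divergenceP Hv; have [Lv _] := Hv.
have w0 := weak_div_lin (-1) Lv Lv Lg Ld vg vd.
have L0 := semi_innerS SI (-1) Lg Ld.
apply: filterS (weak_div_ae0 (semi_innerS SV (-1) Lv Lv) L0 w0 _) => [x + Dx|].
  move=> /(_ Dx); rewrite -[(_ *: _ + _) x]/(-1 * g x + divergence D v x).
  by rewrite mulN1r addrC => /eqP; rewrite subr_eq0 => /eqP.
by apply: aeW => x Dx; rewrite -[LHS]/(-1 *: v x + v x) scaleN1r addNr.
Qed.

Lemma Hdiv_lin a u v : Hdiv D u -> Hdiv D v -> Hdiv D (a *: u + v).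
Proof.
move=> Hu Hv; have [Lu ud] := divergenceP Hu; have [Lv vd] := divergenceP Hv.
have [[L2u _] [L2v _]] := (Hu, Hv).
split; first exact: (semi_innerS SV).
by exists (a *: divergence D u + divergence D v); split; [exact: (semi_innerS SI)|exact: weak_div_lin].
Qed.

(** The chosen representatives need not depend linearly on the field; uniqueness up to null sets
    repairs this. *)
Lemma divergence_lin a u v : Hdiv D u -> Hdiv D v ->
  {ae leb, forall x, D x ->
    divergence D (a *: u + v) x = (a *: divergence D u + divergence D v) x}.
Proof.
move=> Hu Hv; have [Lu ud] := divergenceP Hu; have [Lv vd] := divergenceP Hv.
have [[L2u _] [L2v _]] := (Hu, Hv).
apply: divergence_unique; [exact: Hdiv_lin|exact: (semi_innerS SI)|exact: weak_div_lin].
Qed.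

Lemma ip_divergence_lin a u v q : Hdiv D u -> Hdiv D v -> L2 D q ->
  ip D (divergence D (a *: u + v)) q =
  a * ip D (divergence D u) q + ip D (divergence D v) q.
Proof.
move=> Hu Hv Lq; have [Lu _] := divergenceP Hu; have [Lv _] := divergenceP Hv.
have <- := semi_innerL SI a Lu Lv Lq.
apply: eq_ae_ip => //; last exact: divergence_lin.
- by apply: L2_divergence; exact: Hdiv_lin.
- exact: (semi_innerS SI).
Qed.

Lemma ip_divergence_ae0 v q : Hdiv D v -> L2 D q ->
  {ae leb, forall x, D x -> v x = 0} -> ip D (divergence D v) q = 0.
Proof.
move=> Hv Lq v0; have [Ld vd] := divergenceP Hv.
rewrite (eq_ae_ip mD Ld (semi_inner0 SI) Lq (weak_div_ae0 Hv.1 Ld vd v0)).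
exact: (semi_inner0l SI Lq).
Qed.

Lemma H0div_lin a u v : H0div D u -> H0div D v -> H0div D (a *: u + v).
Proof.
move=> [Hu tu] [Hv tv]; split; first exact: Hdiv_lin.
move=> f sf; rewrite /normal_trace; have Lf := smooth_L2 sf.
have := tu f sf; have := tv f sf; rewrite /normal_trace => tv0 tu0.
have -> := semi_innerL SV a Hu.1 Hv.1 (smooth_L2v_grad sf).
have -> := ip_divergence_lin a Hu Hv Lf.
by rewrite addrACA -mulrDr tu0 tv0 mulr0 addr0.
Qed.

Lemma H0div0 : H0div D 0.
Proof.
have w0 : weak_div D 0 0.
  move=> f [sf _ _]; rewrite (semi_inner0l SV) ?(semi_inner0l SI) ?oppr0//.
    exact: smooth_L2.
  exact: smooth_L2v_grad.
have H0 : Hdiv D 0.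
  by split; [exact: (semi_inner0 SV)|exists 0; split => //; exact: (semi_inner0 SI)].
split => // f sf; rewrite /normal_trace (semi_inner0l SV); last exact: smooth_L2v_grad.
rewrite add0r (@eq_ae_ip _ _ _ _ 0) //.
- exact: (semi_inner0l SI) (smooth_L2 sf).
- exact: L2_divergence.
- exact: (semi_inner0 SI).
- exact: smooth_L2.
- by apply: divergence_unique => //; exact: (semi_inner0 SI).
Qed.

(** The vanishing normal trace is tested with the constant 1, whose gradient is 0. This provides the
    zero mean required by [Qh]. *)
Lemma integral_divergence0 v : H0div D v -> \int[leb]_(x in D) divergence D v x = 0.
Proof.
move=> [Hv tv].
have p0 (a : R) i : partial i (cst a : E -> R) = cst 0.
  by apply/funext => x; rewrite /partial; exact: derive_cst.
have s1 (a : R) : smooth (cst a : E -> R).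
  move=> k; elim: k a => [|k IH] a; first exact: cst_continuous.
  split; first exact: cst_continuous.
  by move=> i; split; [move=> x; exact: derivable_cst|rewrite p0; exact: IH].
have := tv _ (s1 1); rewrite /normal_trace (_ : grad _ = 0); last first.
  by apply/funext => x; apply/rowP => i; rewrite mxE p0 mxE.
rewrite (semi_innerC SV) ?(semi_inner0l SV) ?add0r; [|exact: Hv.1|exact: Hv.1|exact: (semi_inner0 SV)].
by rewrite /ip => e; rewrite -[RHS]e; apply: eq_Rintegral => x _; rewrite mulr1.
Qed.

End divergence.

(** * Riesz representation for a semi-inner product of finite rank *)

Section finite_dimensional_riesz.
Context (R : realType) (X : lmodType R) (S : set X) (B : X -> X -> R).
Context (SB : semi_inner S B) (N : nat) (c : X -> 'rV[R]_N).

(* [c] need not be linear: it only has to turn a linear relation between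
   coordinate vectors into one between vectors, up to [B]-null vectors. *)
Hypothesis c_relation : forall k (e : 'I_k -> X) (a : 'I_k -> R),
  (forall i, S (e i)) -> \sum_i a i *: c (e i) = 0 ->
  B (\sum_i a i *: e i) (\sum_i a i *: e i) = 0.

Definition orthonormal_family k (e : 'I_k -> X) : Prop :=
  (forall i, S (e i)) /\ forall i j, B (e i) (e j) = (i == j)%:R.

Lemma orthonormal_expansion k (e : 'I_k -> X) (a : 'I_k -> R) j :
  orthonormal_family e -> B (\sum_i a i *: e i) (e j) = a j.
Proof.
move=> [Se oe]; rewrite (semi_inner_suml SB)// (bigD1 j)//= big1 => [|i /negbTE ij].
  by rewrite oe eqxx mulr1 addr0.
by rewrite oe ij mulr0.
Qed.

(** More than N coordinate vectors satisfy a nontrivial linear relation. The same combination of the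
    [e i] is then [B]-null, yet its product with [e j] is the coefficient [a j], so Cauchy-Schwarz
    kills every coefficient. *)
Lemma orthonormal_size k (e : 'I_k -> X) : orthonormal_family e -> (k <= N)%N.
Proof.
move=> oe; rewrite leqNgt; apply/negP => Nk; have [Se _] := oe.
pose A := \matrix_i c (e i); have [a a0 aA] := exists_left_kernel A Nk.
have z : \sum_i a ord0 i *: c (e i) = 0.
  by rewrite -[RHS]aA mulmx_sum_row; apply: eq_bigr => i _; rewrite rowK.
have Sy := semi_innerS_sum SB (a ord0) Se.
have := semi_inner_CS SB Sy (Se _); rewrite (c_relation Se z) => h.
case/negP: a0; apply/eqP/rowP => j; rewrite mxE.
have := h j; rewrite mul0r orthonormal_expansion// => h2.
by apply/eqP; rewrite -sqrf_eq0 eq_le h2 sqr_ge0.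
Qed.

(** On a maximal orthonormal family the representative is the sum of the [l (e i) *: e i].
    Subtracting from [w] its projection leaves a vector orthogonal to the family; it must be null,
    since normalizing it would otherwise extend the family, and [l] vanishes on null vectors. *)
Lemma riesz_representation (l : X -> R) :
  (forall a x y, S x -> S y -> l (a *: x + y) = a * l x + l y) ->
  (forall x, S x -> B x x = 0 -> l x = 0) ->
  exists2 v, S v & forall w, S w -> B v w = l w.
Proof.
move=> lL l0; have S0 := semi_inner0 SB.
have ll0 : l 0 = 0 by apply: l0 => //; exact: (semi_inner0l SB).
pose Q k := `[< exists e : 'I_k -> X, orthonormal_family e >].
have exQ : exists k, Q k by exists 0%N; apply/asboolP; exists (fun=> 0); split => [|[]] [].
have Qle k : Q k -> (k <= N)%N by move=> /asboolP[e]; exact: orthonormal_size.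
case: (ex_maxnP exQ Qle) => k /asboolP[e oe] maxk; have [Se eij] := oe.
have Sv a := semi_innerS_sum SB a Se.
exists (\sum_i l (e i) *: e i) => // w Sw.
set v := \sum_i l (e i) *: e i; pose y := \sum_i B w (e i) *: e i.
have Sy : S y by exact: Sv.
have lsum (a : 'I_k -> R) : l (\sum_i a i *: e i) = \sum_i a i * l (e i).
  suff [_ ->] : S (\sum_i a i *: e i) /\
    l (\sum_i a i *: e i) = \sum_i a i * l (e i) by [].
  elim/big_rec2 : _ => [|i x z _ [Sz xz]]; first by [].
  by rewrite lL// xz; split => //; apply: (semi_innerS SB).
have Sz := semi_innerSB SB Sw Sy; set z := w - y in Sz.
have ze j : B z (e j) = 0.
  by rewrite (semi_innerBl SB)// orthonormal_expansion// subrr.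
have zz0 : B z z = 0.
  apply/eqP/negPn/negP => zz; have zzp : 0 < B z z.
    by rewrite lt_neqAle eq_sym zz (semi_inner_ge0 SB).
  pose s := (Num.sqrt (B z z))^-1; pose z1 := s *: z.
  have Sz1 : S z1 by exact: (semi_innerSZ SB).
  have z1e j : B z1 (e j) = 0 by rewrite (semi_innerZl SB)// ze mulr0.
  pose e' (i : 'I_k.+1) := oapp e z1 (unlift ord0 i).
  have : Q k.+1.
    apply/asboolP; exists e'; split => [i|i j].
      by rewrite /e'; case: unliftP => [j|] _ /=.
    rewrite /e'; case: (unliftP ord0 i) => [i'|] ->; case: (unliftP ord0 j) => [j'|] -> /=.
    - by rewrite eij (inj_eq lift_inj).
    - by rewrite (semi_innerC SB)// z1e.
    - by rewrite z1e.
    - rewrite (semi_innerZl SB)// (semi_innerC SB)// (semi_innerZl SB)// mulrA.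
      by rewrite -expr2 exprVn sqr_sqrtr ?ltW// mulVf// eqxx.
  by move=> /maxk; rewrite ltnn.
have lz : l z = 0 by exact: l0.
have wE : w = 1 *: z + y by rewrite scale1r subrK.
rewrite [in RHS]wE lL// lz mulr0 add0r lsum (semi_inner_suml SB)//.
by apply: eq_bigr => i _; rewrite (semi_innerC SB) 1?mulrC.
Qed.

End finite_dimensional_riesz.

(** * Degrees of polynomials and of shape functions *)

Section polynomial_degrees.
Context (R : realType) (n : nat).
Implicit Types p q : mpoly n R.

Lemma msize_leP p k :
  reflect (forall m, (k <= mdeg m)%N -> mcoeff m p = 0) (msize p <= k)%N.
Proof.
apply: (iffP idP) => [pk m km|h].
  by apply/eqP; rewrite mcoeff_eq0; apply: msize_mdeg_ge; exact: leq_trans km.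
rewrite msizeE big_seq; elim/big_ind: _ => // [a b ak bk|m mp].
  by rewrite geq_max ak.
rewrite ltnNge; apply/negP => /h /eqP; rewrite mcoeff_eq0 => /negP; exact.
Qed.

Lemma msize_lin_le a p q k : (msize p <= k)%N -> (msize q <= k)%N ->
  (msize (a *: p + q) <= k)%N.
Proof.
move=> /msize_leP hp /msize_leP hq; apply/msize_leP => m km.
by rewrite mcoeffD mcoeffZ hp// hq// mulr0 addr0.
Qed.

Lemma msize_mderiv_le i p k : (msize p <= k.+1)%N -> (msize (mderiv i p) <= k)%N.
Proof.
move=> /msize_leP hp; apply/msize_leP => m km.
by rewrite mcoeff_deriv hp ?mul0rn// mdegD mdeg1 addn1.
Qed.

Lemma msize_mulX_le p i k : (msize p <= k)%N ->
  (msize (p * mpolyX R (mnm1 i)) <= k.+1)%N.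
Proof.
have [->|p0] := eqVneq p 0; first by rewrite mul0r mmeasure0.
have X0 : mpolyX R (mnm1 i) != 0.
  by rewrite -msize_poly_eq0 msizeX.
by move=> pk; rewrite msizeM// msizeX mdeg1 addn2.
Qed.

Lemma msize_homog r q : q \is ishomog1 r mdeg -> (msize q <= r.+1)%N.
Proof.
move=> hq; apply/msize_leP => m rm; apply: (dhomog_nemf_coeff hq).
by rewrite gtn_eqF.
Qed.

Lemma poly_le_lin r a (f g : 'rV[R]_n -> R) : poly_le r f -> poly_le r g ->
  poly_le r (a *: f + g).
Proof.
move=> [p [sp ->]] [q [sq ->]]; exists (a *: p + q); split; first exact: msize_lin_le.
by apply/funext => x; rewrite /peval mevalD mevalZ.
Qed.

Lemma poly_homog_lin r a (f g : 'rV[R]_n -> R) : poly_homog r f -> poly_homog r g ->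
  poly_homog r (a *: f + g).
Proof.
move=> [p [hp ->]] [q [hq ->]]; exists (a *: p + q); split.
  by apply: rpredD => //; exact: rpredZ.
by apply/funext => x; rewrite /peval mevalD mevalZ.
Qed.

Lemma poly_le0 r : poly_le r (0 : 'rV[R]_n -> R).
Proof.
by exists 0; split; [rewrite mmeasure0|apply/funext => x; rewrite /peval meval0].
Qed.

Lemma poly_homog0 r : poly_homog r (0 : 'rV[R]_n -> R).
Proof.
by exists 0; split; [exact: rpred0|apply/funext => x; rewrite /peval meval0].
Qed.

Lemma poly_le_vec_lin r a (u v : 'rV[R]_n -> 'rV[R]_n) :
  poly_le_vec r u -> poly_le_vec r v -> poly_le_vec r (a *: u + v).
Proof.
move=> hu hv i; rewrite (_ : (fun x => _) =
    a *: (fun x => u x ord0 i) + (fun x => v x ord0 i)); first exact: poly_le_lin.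
by apply/funext => x; rewrite -[(a *: u + v) x]/(a *: u x + v x) !mxE.
Qed.

Lemma poly_le_vec0 r : poly_le_vec r (0 : 'rV[R]_n -> 'rV[R]_n).
Proof.
move=> i; rewrite (_ : (fun x => _) = 0); first exact: poly_le0.
by apply/funext => x; rewrite -[(0 : _ -> _) x]/(0 : 'rV_n) mxE.
Qed.

Lemma shape_functions_lin fam r a (u v : 'rV[R]_n -> 'rV[R]_n) :
  shape_functions fam r u -> shape_functions fam r v ->
  shape_functions fam r (a *: u + v).
Proof.
case: fam => /=; last exact: poly_le_vec_lin.
move=> [u0 [p [hu0 hp uE]]] [v0 [q [hv0 hq vE]]].
exists (a *: u0 + v0), (a *: p + q); split.
- exact: poly_le_vec_lin.
- exact: poly_homog_lin.
- move=> x; rewrite -[(a *: u + v) x]/(a *: u x + v x) uE vE.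
  rewrite -[(a *: u0 + v0) x]/(a *: u0 x + v0 x) -[(a *: p + q) x]/(a * p x + q x).
  by rewrite scalerDr scalerDl scalerA addrACA.
Qed.

Lemma shape_functions0 fam r : shape_functions fam r (0 : 'rV[R]_n -> 'rV[R]_n).
Proof.
case: fam => /=; last exact: poly_le_vec0.
exists 0, 0; split; [exact: poly_le_vec0|exact: poly_homog0|move=> x].
by rewrite -[(0 : 'rV[R]_n -> R) x]/(0 : R) scale0r addr0.
Qed.

(** Both families consist of fields of degree at most r+1, that is [msize] at most [r.+2]; their
    divergences have degree at most r, as [Qh] requires. *)
Lemma shape_functions_mpoly fam r (v : 'rV[R]_n -> 'rV[R]_n) :
  shape_functions fam r v -> exists P : 'I_n -> mpoly n R,
    (forall i, (msize (P i) <= r.+2)%N) /\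
    forall x i, v x ord0 i = peval (P i) x.
Proof.
case: fam => /=; last first.
  move=> /choice[P hP]; exists P; split => [i|x i]; first by have [] := hP i.
  by have [_ /(congr1 (@^~ x))] := hP i.
move=> [v0 [q [/choice[P hP] [Q [hQ ->]] vE]]].
exists (fun i => P i + Q * mpolyX R (mnm1 i)); split => [i|x i].
  rewrite -[P i]scale1r; apply: msize_lin_le.
    by have [h _] := hP i; exact: leq_trans h _.
  by apply: msize_mulX_le; exact: msize_homog.
rewrite vE !mxE /peval mevalD mevalM mevalXU; congr (_ + _).
by have [_ /(congr1 (@^~ x))] := hP i.
Qed.

End polynomial_degrees.

Lemma msize_mdiv_le (R : realType) n (P : 'I_n.+1 -> mpoly n.+1 R) k :
  (forall i, (msize (P i) <= k.+1)%N) -> (msize (mdiv P) <= k)%N.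
Proof.
move=> Pk; rewrite /mdiv; elim/big_ind: _ => [|p q pk qk|i _].
- by rewrite mmeasure0.
- by rewrite -[p]scale1r msize_lin_le.
- exact: msize_mderiv_le.
Qed.

(** * The discrete spaces, the energy form and the discrete gradient *)

Section finite_element_spaces.
Context (R : realType) (n : nat).
Local Notation E := 'rV[R]_n.+1.
Local Notation leb := (lebesgue_rV R n.+1).
Context (D : set E) (oD : open D) (bD : bounded_set D) (lipD : lipschitz_boundary D).
Context (Th : mesh D) (fam : fe_family) (r : nat).
Implicit Types (u v w : E -> E) (f g q : E -> R).

Let mD : measurable D := open_measurable_rV oD.
Let SI := semi_inner_ip mD.
Let SV := semi_inner_ipv mD.

Lemma ae_cells (Q : E -> Prop) :
  (forall T, cell Th T -> {ae leb, forall x, T x -> Q x}) ->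
  {ae leb, forall x, D x -> Q x}.
Proof.
case: Th => I p cs ? cs_cover ? H.
have Hs (s : {set I}) : {ae leb, forall x, s \in cs -> hull p s x -> Q x}.
  have [sc|_] := boolP (s \in cs); last exact: aeW.
  by apply: filterS (H (hull p s) _) => [x hx _|]; [exact: hx|exists s].
apply: filterS (filter_forall _ Hs) => x Hx Dx.
have : closure D x by exact: subset_closure.
by rewrite cs_cover => -[s /= sc]; exact: Hx.
Qed.

Lemma piecewise_lin (V : lmodType R) (S : (E -> V) -> Prop) (a : R) (f g : E -> V) :
  (forall f' g' : E -> V, S f' -> S g' -> S (a *: f' + g')) ->
  piecewise Th S f -> piecewise Th S g -> piecewise Th S (a *: f + g).
Proof.
move=> SL pf pg T cT; have [f' Sf' ff'] := pf _ cT; have [g' Sg' gg'] := pg _ cT.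
exists (a *: f' + g'); first exact: SL.
apply: filterS2 ff' gg' => x fx gx Tx.
by rewrite -[(a *: f + g) x]/(a *: f x + g x) fx// gx.
Qed.

Lemma Vh_lin a u v : Vh Th fam r u -> Vh Th fam r v -> Vh Th fam r (a *: u + v).
Proof.
move=> [Hu pu] [Hv pv]; split; first exact: H0div_lin.
by apply: piecewise_lin => // f' g'; exact: shape_functions_lin.
Qed.

Lemma Vh0 : Vh Th fam r 0.
Proof.
split; first exact: H0div0.
by move=> T _; exists 0; [exact: shape_functions0|exact: aeW].
Qed.

Lemma Qh_lin a q q' : Qh Th r q -> Qh Th r q' -> Qh Th r (a *: q + q').
Proof.
move=> [Lq pq q0] [Lq' pq' q'0]; split.
- exact: (semi_innerS SI).
- by apply: piecewise_lin => // f' g'; exact: poly_le_lin.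
- have iq := L2_integrable mD bD Lq; have iq' := L2_integrable mD bD Lq'.
  transitivity (\int[leb]_(x in D) (a * q x + q' x)); first by [].
  rewrite RintegralD//; last exact: (integrableZl mD a iq).
  by rewrite RintegralZl// q0 q'0 mulr0 addr0.
Qed.

Lemma divergence_Qh v : Vh Th fam r v -> Qh Th r (divergence D v).
Proof.
move=> [Hv pv]; have [[Lv _] _] := Hv; have [Ld vd] := divergenceP Hv.1; split => //.
- move=> T cT; have [g Sg vg] := pv _ cT.
  have [P [sP gP]] := shape_functions_mpoly Sg.
  have [TD nT] := mesh_cell_interior lipD cT.
  exists (peval (mdiv P)).
    by exists (mdiv P); split => //; exact: msize_mdiv_le.
  have dP : {ae leb, forall x, T° x -> divergence D v x = peval (mdiv P) x}.
    apply: (weak_div_open oD (open_interior T) TD Lv Ld vd).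
    by apply: filterS vg => x + /interior_subset Tx i => /(_ Tx) ->.
  have nb : {ae leb, forall x, T x -> T° x}.
    by apply: negligibleS nT => x /= /not_implyP[].
  by apply: filterS2 dP nb => x h1 h2 /h2/h1.
- exact: integral_divergence0.
Qed.

(** A vertex set, a component and a monomial of degree at most r+1. Taking all vertex sets rather
    than the cells alone still gives a finite bound on the dimension. *)
Definition coord_index := ({set vertex Th} * 'I_n.+1 * bmultinom n.+1 r.+2)%type.

(** The coordinates are the coefficients of polynomials chosen cell by cell, a choice made
    separately for each field. A relation between the coefficient vectors annihilates the
    combination of the chosen polynomials on every cell, hence the combination of the fields almost
    everywhere. *)
Lemma Vh_coordinates : exists c : (E -> E) -> 'rV[R]_#|{: coord_index}|,
  forall k (e : 'I_k -> E -> E) (a : 'I_k -> R),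
  (forall i, Vh Th fam r (e i)) -> \sum_i a i *: c (e i) = 0 ->
  {ae leb, forall x, D x -> (\sum_i a i *: e i) x = 0}.
Proof.
have /choice[P hP] v : exists P : {set vertex Th} -> 'I_n.+1 -> mpoly n.+1 R,
    Vh Th fam r v -> forall s, s \in cells Th ->
    (forall i, (msize (P s i) <= r.+2)%N) /\
    {ae leb, forall x, hull (Defs.point (m:=Th)) s x -> forall i, v x ord0 i = peval (P s i) x}.
  have [Vv|nVv] := pselect (Vh Th fam r v); last by exists (fun _ _ => 0).
  have /choice[P hP] s : exists P : 'I_n.+1 -> mpoly n.+1 R, s \in cells Th ->
    (forall i, (msize (P i) <= r.+2)%N) /\
    {ae leb, forall x, hull (Defs.point (m:=Th)) s x -> forall i, v x ord0 i = peval (P i) x}.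
    have [sc|nsc] := pselect (s \in cells Th); last by exists (fun _ => 0).
    have [|g Sg vg] := Vv.2 (hull (Defs.point (m:=Th)) s); first by exists s.
    have [P [sP gP]] := shape_functions_mpoly Sg; exists P => _; split => //.
    by apply: filterS vg => x + Tx i => /(_ Tx) ->.
  by exists P.
pose co v (t : coord_index) := mcoeff (bmnm t.2) (P v t.1.1 t.1.2).
exists (fun v => \row_j co v (enum_val j)).
move=> k e a Ve rel; apply: ae_cells => T [s sc ->].
have He j := (hP (e j) (Ve j) s sc).2.
have P0 i : \sum_j a j *: P (e j) s i = 0.
  apply/mpolyP => m; rewrite mcoeff0 raddf_sum /=.
  under eq_bigr do rewrite mcoeffZ.
  have [rm|mr] := leqP r.+2 (mdeg m).
    rewrite big1// => j _; have /msize_leP -> := (hP (e j) (Ve j) s sc).1 i => //.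
    by rewrite mulr0.
  pose t : coord_index := (s, i, BMultinom mr).
  have /rowP/(_ (enum_rank t)) := rel; rewrite summxE mxE => h.
  by rewrite -[RHS]h; apply: eq_bigr => j _; rewrite !mxE enum_rankK.
apply: filterS (filter_forall _ He) => x Hx Tx; apply/rowP => i; rewrite mxE.
have -> : (\sum_j a j *: e j) x ord0 i = \sum_j a j * e j x ord0 i.
  elim/big_rec2: _ => [|j y z _ <-]; first by rewrite -[(0 : E -> E) x]/(0 : E) mxE.
  by rewrite -[(a j *: e j + z) x]/(a j *: e j x + z x) !mxE.
under eq_bigr do rewrite Hx//.
transitivity (peval (\sum_j a j *: P (e j) s i) x).
  by rewrite /peval raddf_sum; apply: eq_bigr => j _; rewrite /= mevalZ.
by rewrite P0 /peval meval0.
Qed.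

(* [lambda = 0] yields the discrete gradient, [lambda = 1] the field of (iv). *)
Section energy_form.
Context (kappa lambda : R) (kappa0 : 0 < kappa) (lambda0 : 0 <= lambda).

Definition energy u v : R :=
  kappa * ipv D u v + lambda * ip D (divergence D u) (divergence D v).

Lemma semi_inner_energy : semi_inner (Vh Th fam r) energy.
Proof.
have HL v : Vh Th fam r v -> L2v D v by move=> [[[]]].
have HH v : Vh Th fam r v -> Hdiv D v by move=> [[]].
have Hd v : Vh Th fam r v -> L2 D (divergence D v).
  by move=> /HH /divergenceP[].
split.
- exact: Vh0.
- exact: Vh_lin.
- move=> u v Vu Vv; rewrite /energy (semi_innerC SV (HL _ Vu) (HL _ Vv)).
  by rewrite (semi_innerC SI (Hd _ Vu) (Hd _ Vv)).
- move=> a u v w Vu Vv Vw; rewrite /energy.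
  rewrite (semi_innerL SV a (HL _ Vu) (HL _ Vv) (HL _ Vw)).
  rewrite (ip_divergence_lin oD bD a (HH _ Vu) (HH _ Vv) (Hd _ Vw)).
  move: (ipv D u w) (ipv D v w) (ip D (divergence D u) _) (ip D (divergence D v) _).
  by move=> uw vw duw dvw; ring.
- move=> v Vv; rewrite addr_ge0// mulr_ge0//; first exact: ltW.
    exact: (semi_inner_ge0 SV (HL _ Vv)).
  exact: (semi_inner_ge0 SI (Hd _ Vv)).
Qed.

(** Since [kappa] is positive, a field of zero energy vanishes almost everywhere, and so does its
    divergence; hence the functional vanishes on null vectors even when [lambda] is 0. *)
Lemma riesz_energy q : L2 D q -> exists2 v, Vh Th fam r v &
  forall w, Vh Th fam r w -> energy v w = ip D (divergence D w) q.
Proof.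
have HL v : Vh Th fam r v -> L2v D v by move=> [[[]]].
have HH v : Vh Th fam r v -> Hdiv D v by move=> [[]].
have Hd v : Vh Th fam r v -> L2 D (divergence D v).
  by move=> /HH /divergenceP[].
have div0 v g : Vh Th fam r v -> L2 D g ->
    {ae leb, forall x, D x -> v x = 0} -> ip D (divergence D v) g = 0.
  by move=> /HH Hv Lg v0; exact: ip_divergence_ae0.
move=> Lq; have [c hc] := Vh_coordinates.
apply: (riesz_representation semi_inner_energy (c := c)).
- move=> k e a Ve rel; have Vs := semi_innerS_sum semi_inner_energy a Ve.
  have s0 := hc k e a Ve rel; rewrite /energy (div0 _ _ Vs (Hd _ Vs) s0) mulr0 addr0.
  rewrite (eq_ae_ipv mD (HL _ Vs) (semi_inner0 SV) (HL _ Vs) s0).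
  by rewrite (semi_inner0l SV (HL _ Vs)) mulr0.
- by move=> a u v Vu Vv; rewrite (ip_divergence_lin oD bD a (HH _ Vu) (HH _ Vv) Lq).
- move=> v Vv; rewrite /energy => /eqP.
  have v0 := semi_inner_ge0 SV (HL _ Vv).
  have d0 := semi_inner_ge0 SI (Hd _ Vv).
  rewrite paddr_eq0 ?mulr_ge0// ?ltW// => /andP[/eqP vv _]; apply: div0 => //.
  apply: ipv_eq0 (HL _ Vv) _ => //; move/eqP: vv.
  by rewrite mulf_eq0 gt_eqF//= => /eqP.
Qed.

End energy_form.

(** Guarantees that [xget] returns a genuine solution and not its default value. *)
Lemma discrete_gradP q : L2 D q -> Vh Th fam r (discrete_grad Th fam r q) /\
  forall v, Vh Th fam r v ->
    ipv D (discrete_grad Th fam r q) v = - ip D q (divergence D v).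
Proof.
move=> Lq; have [v Vv vE] := riesz_energy ltr01 (lexx 0) Lq.
apply: (@xgetPex _ (cst 0) [set s | Vh Th fam r s /\
    forall v, Vh Th fam r v -> ipv D s v = - ip D q (divergence D v)]).
exists (-1 *: v + 0); split; first by apply: Vh_lin => //; exact: Vh0.
have HL w : Vh Th fam r w -> L2v D w by move=> [[[]]].
move=> w Vw; rewrite (semi_innerL SV _ (HL _ Vv) (semi_inner0 SV) (HL _ Vw)).
have [Ld _] := divergenceP Vw.1.1.
rewrite (semi_inner0l SV (HL _ Vw)) addr0 mulN1r (semi_innerC SI Lq Ld) -vE//.
by rewrite /energy mul1r mul0r addr0.
Qed.

End finite_element_spaces.

(** * The four Brezzi conditions *)

Section darcy_norms.
Context (R : realType) (n : nat).
Local Notation E := 'rV[R]_n.+1.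
Local Notation leb := (lebesgue_rV R n.+1).
Context (D : set E) (oD : open D) (bD : bounded_set D) (lipD : lipschitz_boundary D).
Context (Th : mesh D) (fam : fe_family) (r : nat).
Context (K : R) (K0 : 0 < K) (K1 : K < 1).
Implicit Types (u v w z : E -> E) (q x y : E -> R).

Let mD : measurable D := open_measurable_rV oD.
Let SI := semi_inner_ip mD.
Let SV := semi_inner_ipv mD.

Let V_L2v v : Vh Th fam r v -> L2v D v. Proof. by move=> [[[]]]. Qed.
Let V_Hdiv v : Vh Th fam r v -> Hdiv D v. Proof. by move=> [[]]. Qed.
Let V_L2d v : Vh Th fam r v -> L2 D (divergence D v).
Proof. by move=> /V_Hdiv /divergenceP[]. Qed.

Lemma normr_le_sqr (a b : R) : 0 <= b -> a ^+ 2 <= b ^+ 2 -> `|a| <= b.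
Proof. by move=> b0 ab; rewrite -(ger0_norm b0) -!sqrtr_sqr ler_wsqrtr. Qed.

Lemma normL2_sqr q : L2 D q -> normL2 D q ^+ 2 = ip D q q.
Proof. by move=> Lq; rewrite sqr_sqrtr// (semi_inner_ge0 SI Lq). Qed.

Lemma normL2v_sqr v : L2v D v -> normL2v D v ^+ 2 = ipv D v v.
Proof. by move=> Lv; rewrite sqr_sqrtr// (semi_inner_ge0 SV Lv). Qed.

Lemma norm_scale_sqr (X : zmodType) (a : R) (N : X -> R) t :
  norm_scale a N t ^+ 2 = a ^+ 2 * N t ^+ 2.
Proof. by rewrite sqr_sqrtr// mulr_ge0// sqr_ge0. Qed.

Lemma norm_Vh_ge0 v : 0 <= norm_Vh D K v. Proof. exact: sqrtr_ge0. Qed.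

Lemma norm_Vh_sqr v : Vh Th fam r v -> norm_Vh D K v ^+ 2 =
  K^-1 * ipv D v v + (ipv D v v + ip D (divergence D v) (divergence D v)).
Proof.
move=> Vv; rewrite sqr_sqrtr ?addr_ge0 ?sqr_ge0// norm_scale_sqr.
rewrite [normHdiv D v ^+ 2]sqr_sqrtr ?addr_ge0 ?sqr_ge0//.
by rewrite normL2v_sqr ?normL2_sqr ?exprVn ?sqr_sqrtr ?(ltW K0)//; auto.
Qed.

(** The squared norm exceeds the energy by the unweighted term [ipv D v v], which for [K < 1] is at
    most [K^-1] times itself; hence a factor 2 uniform in [K]. *)
Lemma norm_Vh_sqr_energy v : Vh Th fam r v ->
  energy D K^-1 1 v v <= norm_Vh D K v ^+ 2 <= 2 * energy D K^-1 1 v v.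
Proof.
move=> Vv; rewrite norm_Vh_sqr// /energy mul1r.
have := semi_inner_ge0 SV (V_L2v Vv); have := semi_inner_ge0 SI (V_L2d Vv).
move: (ipv D v v) (ip D _ _) => a b b0 a0.
have : a <= K^-1 * a by rewrite ler_peMl// invf_ge1// ltW.
lra.
Qed.

Lemma a_formE u v : Vh Th fam r u -> Vh Th fam r v ->
  a_form D K u v = K^-1 * ipv D u v.
Proof. by move=> /V_L2v Lu /V_L2v Lv; exact: (semi_innerZl SV K^-1 Lu Lv). Qed.

Lemma a_form_bounded u v : Vh Th fam r u -> Vh Th fam r v ->
  `|a_form D K u v| <= norm_Vh D K u * norm_Vh D K v.
Proof.
move=> Vu Vv; apply: normr_le_sqr; first by rewrite mulr_ge0// norm_Vh_ge0.
have := norm_Vh_sqr Vu; have := norm_Vh_sqr Vv; rewrite (a_formE Vu Vv).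
move: (norm_Vh D K u) (norm_Vh D K v) => Nu Nv Nv2 Nu2.
rewrite [leRHS]exprMn Nu2 Nv2 exprMn {Nu Nv Nu2 Nv2}.
have Ki : 0 <= K^-1 by rewrite invr_ge0 ltW.
have := semi_inner_CS SV (V_L2v Vu) (V_L2v Vv).
have := semi_inner_ge0 SV (V_L2v Vu); have := semi_inner_ge0 SI (V_L2d Vu).
have := semi_inner_ge0 SV (V_L2v Vv); have := semi_inner_ge0 SI (V_L2d Vv).
move: (ipv D u v) (ipv D u u) (ipv D v v) (ip D (divergence D u) _)
  (ip D (divergence D v) _) => uv uu vv du dv dv0 vv0 du0 uu0 cs.
apply: (@le_trans _ _ ((K^-1 * uu) * (K^-1 * vv))).
  by rewrite [leRHS]mulrACA -(expr2 K^-1); apply: ler_wpM2l => //; exact: sqr_ge0.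
by apply: ler_pM; rewrite ?mulr_ge0// lerDl addr_ge0.
Qed.

(** The divergence of [z] is itself an admissible [q], which makes its L^2 norm vanish. *)
Lemma a_form_coercive z : Zh Th fam r z ->
  2^-1 * norm_Vh D K z ^+ 2 <= a_form D K z z.
Proof.
move=> [Vz bz]; have N2 := norm_Vh_sqr Vz; rewrite (a_formE Vz Vz) {}N2.
have -> : ip D (divergence D z) (divergence D z) = 0.
  exact: bz (divergence_Qh oD lipD Vz).
have := semi_inner_ge0 SV (V_L2v Vz); move: (ipv D z z) => a a0.
have : a <= K^-1 * a by rewrite ler_peMl// invf_ge1// ltW.
lra.
Qed.

Definition decomposition_costs q : set R :=
  [set d | exists x y, [/\ Qh Th r x, Qh Th r y, q = x + y &
    d = normL2 D x ^+ 2 +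
        norm_scale (Num.sqrt K) (norm1h Th fam r) y ^+ 2]].

Lemma decomposition_costs_ge0 q : lbound (decomposition_costs q) 0.
Proof. by move=> _ [x [y [_ _ _ ->]]]; rewrite addr_ge0// sqr_ge0. Qed.

Lemma decomposition_costs_neq0 q : Qh Th r q -> decomposition_costs q !=set0.
Proof.
move=> Qq; have Q0 := Qh_lin oD bD (-1) Qq Qq.
eexists; exists q, (-1 *: q + q); split => //.
by rewrite scaleN1r addNr addr0.
Qed.

Lemma norm_Qh_sqr q : Qh Th r q ->
  norm_Qh Th fam r K q ^+ 2 = inf (decomposition_costs q).
Proof.
move=> Qq; rewrite sqr_sqrtr//.
apply: lb_le_inf; [exact: decomposition_costs_neq0|exact: decomposition_costs_ge0].
Qed.

Lemma cost_summandE y : Qh Th r y ->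
  norm_scale (Num.sqrt K) (norm1h Th fam r) y ^+ 2 =
  K * ipv D (discrete_grad Th fam r y) (discrete_grad Th fam r y).
Proof.
move=> [Ly _ _]; have [VG _] := discrete_gradP oD bD Th fam r Ly.
by rewrite norm_scale_sqr sqr_sqrtr ?(ltW K0)// normL2v_sqr//; exact: V_L2v.
Qed.

(** Moving the divergence onto [y] gives b(v, x + y) = (div v, x) - (grad_h y, v). A Cauchy-Schwarz
    inequality for pairs follows, pairing div v with x and the weighted K^(-1/2) v with K^(1/2)
    grad_h y. *)
Lemma b_form_sqr_le v x y : Vh Th fam r v -> Qh Th r x -> Qh Th r y ->
  b_form D v (x + y) ^+ 2 <= norm_Vh D K v ^+ 2 *
    (normL2 D x ^+ 2 + norm_scale (Num.sqrt K) (norm1h Th fam r) y ^+ 2).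
Proof.
move=> Vv Qx Qy; have [[Lx _ _] [Ly _ _]] := (Qx, Qy).
rewrite (normL2_sqr Lx) (cost_summandE Qy); have -> := norm_Vh_sqr Vv.
have [VG GE] := discrete_gradP oD bD Th fam r Ly.
set G := discrete_grad Th fam r y in VG GE *.
have Ld := V_L2d Vv; set d := divergence D v in Ld GE *.
have -> : b_form D v (x + y) = ip D d x - ipv D G v.
  rewrite /b_form (semi_innerC SI Ld (semi_innerSD SI Lx Ly)).
  rewrite (semi_innerDl SI Lx Ly Ld) GE// opprK.
  by rewrite (semi_innerC SI Lx Ld).
have := semi_inner_CS SI Ld Lx; have := semi_inner_CS SV (V_L2v VG) (V_L2v Vv).
have := semi_inner_ge0 SI Ld; have := semi_inner_ge0 SI Lx.
have := semi_inner_ge0 SV (V_L2v VG); have := semi_inner_ge0 SV (V_L2v Vv).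
move: (ip D d x) (ipv D G v) (ip D d d) (ip D x x) (ipv D G G) (ipv D v v).
move=> p s dd xx gg vv vv0 gg0 xx0 dd0 sle ple.
(* [A] and [B] are the mixed terms of (K^-1 vv + dd)(xx + K gg). Since (ps)^2 is at most AB, the
   arithmetic-geometric mean inequality bounds the cross term |2ps| by A + B. *)
pose A := K * dd * gg; pose B := K^-1 * vv * xx.
have AB : A * B = (dd * xx) * (gg * vv).
  by rewrite /A /B; field; rewrite gt_eqF.
have Ki : 0 <= K^-1 by rewrite invr_ge0 ltW.
have A0 : 0 <= A by rewrite !mulr_ge0// ltW.
have B0 : 0 <= B by rewrite !mulr_ge0.
have ps : `|2 * (p * s)| <= A + B.
  apply: normr_le_sqr; first exact: addr_ge0.
  have : (p * s) ^+ 2 <= A * B by rewrite AB exprMn; apply: ler_pM; rewrite ?sqr_ge0.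
  have : 0 <= (A - B) ^+ 2 by exact: sqr_ge0.
  by rewrite sqrrB sqrrD exprMn; lra.
apply: (@le_trans _ _ ((K^-1 * vv + dd) * (xx + K * gg))); last first.
  by apply: ler_wpM2r; [rewrite addr_ge0// mulr_ge0// ltW|rewrite lerD2l lerDr].
rewrite (_ : (_ + _) * _ = dd * xx + gg * vv + (A + B)); last first.
  by rewrite /A /B; field; rewrite gt_eqF.
move: ps; rewrite ler_norml => /andP[ps _].
by rewrite sqrrB; lra.
Qed.

Lemma b_form_bounded v q : Vh Th fam r v -> Qh Th r q ->
  `|b_form D v q| <= norm_Vh D K v * norm_Qh Th fam r K q.
Proof.
move=> Vv Qq; apply: normr_le_sqr; first by rewrite mulr_ge0// sqrtr_ge0.
rewrite exprMn norm_Qh_sqr//.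
have H d : decomposition_costs q d -> b_form D v q ^+ 2 <= norm_Vh D K v ^+ 2 * d.
  by move=> [x [y [Qx Qy -> ->]]]; exact: b_form_sqr_le.
(* Passing to the infimum divides by the squared norm of [v]; if that norm is 0, any single
   decomposition suffices. *)
have := sqr_ge0 (norm_Vh D K v); rewrite le_eqVlt => /orP[/eqP N0|N0].
  have [d dI] := decomposition_costs_neq0 Qq.
  by have := H d dI; rewrite -N0 !mul0r.
rewrite -ler_pdivrMl//; apply: lb_le_inf; first exact: decomposition_costs_neq0.
by move=> d /H; rewrite -ler_pdivrMl.
Qed.

Lemma inf_sup q : Qh Th r q ->
  2^-1 * norm_Qh Th fam r K q <= b_sup Th fam r K q.
Proof.
move=> Qq; have [Lq _ _] := Qq; have Ki : 0 < K^-1 by rewrite invr_gt0.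
have SE := semi_inner_energy oD bD Th fam r Ki ler01.
have [v Vv vE] := riesz_energy oD bD Th fam r Ki ler01 Lq.
have bE w : Vh Th fam r w -> b_form D w q = energy D K^-1 1 v w.
  by move=> Vw; rewrite vE.
set M := energy D K^-1 1 v v.
have M0 : 0 <= M by exact: (semi_inner_ge0 SE Vv).
have Qd := divergence_Qh oD lipD Vv; have Ld := V_L2d Vv.
pose y := -1 *: divergence D v + q.
have Qy : Qh Th r y by exact: Qh_lin.
have [Ly _ _] := Qy.
have [VG GE] := discrete_gradP oD bD Th fam r Ly.
set G := discrete_grad Th fam r y in VG GE.
(* By definition (G, w) = (div v, div w) - (q, div w), and (q, div w) is the energy product of [v]
   and [w]; the divergence terms cancel. *)
have Gw w : Vh Th fam r w -> ipv D G w = - (K^-1 * ipv D v w).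
  move=> Vw; rewrite GE// (semi_innerL SI (-1) Ld Lq (V_L2d Vw)).
  rewrite (semi_innerC SI Lq (V_L2d Vw)) -vE// /energy; ring.
(* The identity is used with [w] equal to [G] and then to [v], so no pointwise formula for [G] is
   required. *)
have GG : ipv D G G = K^-1 ^+ 2 * ipv D v v.
  rewrite Gw// (semi_innerC SV (V_L2v Vv) (V_L2v VG)) Gw//; ring.
have costM : decomposition_costs q M.
  exists (divergence D v), y; split => //.
    by rewrite /y scaleN1r addrA subrr add0r.
  rewrite normL2_sqr// cost_summandE// GG /M /energy mul1r addrC; congr (_ + _).
  by field; rewrite gt_eqF.
have qM : norm_Qh Th fam r K q <= Num.sqrt M.
  rewrite ler_wsqrtr//; apply: ge_inf => //.
  by exists 0; exact: decomposition_costs_ge0.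
have le_energy w : Vh Th fam r w -> Num.sqrt (energy D K^-1 1 w w) <= norm_Vh D K w.
  move=> Vw; have /andP[h _] := norm_Vh_sqr_energy Vw.
  by rewrite -[leRHS](ger0_norm (norm_Vh_ge0 w)) -sqrtr_sqr ler_wsqrtr.
have ub w : Vh Th fam r w -> b_form D w q / norm_Vh D K w <= Num.sqrt M.
  move=> Vw; have := norm_Vh_ge0 w; rewrite le_eqVlt => /orP[/eqP <-|N0].
    by rewrite invr0 mulr0 sqrtr_ge0.
  rewrite ler_pdivrMr// bE// (le_trans (ler_norm _))//.
  apply: le_trans (semi_inner_norm_CS SE Vv Vw) _.
  by rewrite ler_wpM2l ?sqrtr_ge0// le_energy.
(* If [M = 0], the norm of [q] is 0 and every quotient under the supremum is 0; an empty set of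
   quotients also has [sup] equal to 0. *)
have [M00|Mn0] := eqVneq M 0.
  apply: (@le_trans _ _ 0).
    by rewrite mulr_ge0_le0// (le_trans qM)// M00 sqrtr0.
  have b0 w : Vh Th fam r w -> b_form D w q = 0.
    move=> Vw; rewrite (bE _ Vw); have := semi_inner_CS SE Vv Vw.
    rewrite [X in _ <= X * _]M00 mul0r; move: (energy _ _ _ v w) => s s0.
    by apply/eqP; rewrite -sqrf_eq0 eq_le s0 sqr_ge0.
  rewrite /b_sup; set I := (X in sup X).
  have [->|/set0P[d dI]] := eqVneq I set0; first by rewrite sup0.
  have d0 : d = 0 by case: dI => w [Vw _ ->]; rewrite b0// mul0r.
  rewrite -{1}d0; apply: ub_le_sup => //.
  by exists 0 => _ [w [Vw _ ->]]; rewrite b0// mul0r.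
have Mp : 0 < M by rewrite lt_neqAle eq_sym Mn0.
apply: (@le_trans _ _ (b_form D v q / norm_Vh D K v)); last first.
  apply: ub_le_sup.
    by exists (Num.sqrt M) => _ [w [Vw _ ->]]; exact: ub.
  (* [v] competes in the supremum: were it null almost everywhere, [M], which equals b(v, q), would
     be 0. *)
  exists v; split => // v0; case/negP: Mn0; apply/eqP.
  by rewrite /M (vE _ Vv); exact: (ip_divergence_ae0 oD (V_Hdiv Vv) Lq v0).
rewrite (bE _ Vv) -/M; apply: (@le_trans _ _ (2^-1 * Num.sqrt M)).
  by rewrite ler_wpM2l// invr_ge0.
have sM : 0 < Num.sqrt M by rewrite sqrtr_gt0.
have Np : 0 < norm_Vh D K v by apply: lt_le_trans sM (le_energy _ Vv).
have /andP[_ N2] := norm_Vh_sqr_energy Vv.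
(* The energy bound gives the factor sqrt 2; rounding it up to 2 makes the constant of (iv) equal to
   1/2. *)
have Nle : norm_Vh D K v <= 2 * Num.sqrt M.
  rewrite -(ger0_norm (norm_Vh_ge0 v)); apply: normr_le_sqr; first by rewrite mulr_ge0// ltW.
  apply: le_trans N2 _; rewrite exprMn (sqr_sqrtr M0) -/M.
  by rewrite (ler_wpM2r M0)// -natrX ler_nat.
rewrite (ler_pdivlMr _ _ Np) -[leRHS](sqr_sqrtr M0); move: Nle sM.
move: (Num.sqrt M) (norm_Vh D K v) => s N Ns s0.
have := ler_wpM2l (ltW s0) Ns; lra.
Qed.

End darcy_norms.

Theorem proposition2 (R : realType) (n : nat) (hn : n = 2%N \/ n = 3%N)
    (Omega : set 'rV[R]_n) (hOmega : bounded_lipschitz_domain Omega)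
    (Th : mesh Omega) (sigma : R) (hTh : shape_regular sigma Th)
    (fam : fe_family) (r : nat) :
  exists Ca Cb alpha beta : R,
  [/\ 0 < Ca, 0 < Cb, 0 < alpha & 0 < beta] /\
  forall K : R, 0 < K < 1 ->
  [/\ forall u v, Vh Th fam r u -> Vh Th fam r v ->
        `|a_form Omega K u v| <=
          Ca * norm_Vh Omega K u * norm_Vh Omega K v,
      forall v q, Vh Th fam r v -> Qh Th r q ->
        `|b_form Omega v q| <=
          Cb * norm_Vh Omega K v * norm_Qh Th fam r K q,
      forall z, Zh Th fam r z ->
        alpha * norm_Vh Omega K z ^+ 2 <= a_form Omega K z z
    & forall q, Qh Th r q ->
        beta * norm_Qh Th fam r K q <= b_sup Th fam r K q].
Proof.
case: n hn Omega hOmega Th hTh => [[]//|m _] D [_ oD _ bD lipD] Th _.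
exists 1, 1, 2^-1, 2^-1; split; first by rewrite invr_gt0 !ltr01 ltr0n.
move=> K /andP[K0 K1]; split.
- by move=> u v Vu Vv; rewrite mul1r; apply: (@a_form_bounded _ _ _ oD Th fam r).
- by move=> v q Vv Qq; rewrite mul1r; exact: b_form_bounded.
- by move=> z Zz; exact: a_form_coercive Zz.
- by move=> q Qq; exact: inf_sup.
Qed.
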